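(* For $j\ne k$ in $\mathcal J$, the counting process $N_{jk}(t)=\#\{s\in(0,t]:Z(s-)=j,Z(s)=k\}$ has $(\mathbb F^Z,\mathbb P)$-compensator $d\Lambda_{jk}(t)=\lambda_{jk}(t)\,dt$ with $$\lambda_{jk}(t)=\sum_{n\in\mathbb N_0}1_{(T_n,T_{n+1}]}(t)\,1_{(Y_n=j)}\,\frac{\alpha(S_{n-1},T_n,j)\prod_{T_n}^{t}\big(I+M_{jj}(x)\,dx\big)}{\alpha(S_{n-1},T_n,j)\prod_{T_n}^{t}\big(I+M_{jj}(x)\,dx\big)\mathbf 1_{d_j}}\,M_{jk}(t)\mathbf 1_{d_k},$$ where $\alpha(S_{n-1},T_n,j)=\alpha(S_n)$ on $\{Y_n=j\}$.
   Context: Product integral: for a square matrix function $A$, $\prod_t^s(I+A(x)\,dx)$ denotes the solution $F(t,s)$ of $\partial_s F(t,s)=F(t,s)A(s)$, $F(t,t)=I$. $\mathbf 1_d$ is the $d$-dimensional column vector of ones. Aggregate Markov model: let $\mathcal J=\{1,\ldots,J\}$ be the set of macrostates and to each $j\in\mathcal J$ assign $d_j\ge1$ microstates; the state space is $E=\{(j,\tilde j): j\in\mathcal J,\ \tilde j\in\{1,\ldots,d_j\}\}$. Let $X=(X_1,X_2)$ be a time-inhomogeneous Markov jump process on $E$ with (suitably regular) transition intensity matrix function $M(t)$, written in block form with blocks $M_{jk}(t)$ of dimension $d_j\times d_k$: $M_{jj}(t)$ are sub-intensity matrices and $M_{jk}(t)$, $j\ne k$, are non-negative. The initial distribution of $X$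 is $(\pi_1(0),\mathbf 0)$ with $\pi_1(0)$ a probability row vector on the microstates of macrostate $1$. The macrostate process is $Z=X_1$ and $\mathbb F^Z$ is its natural filtration. Let $(T_n)_{n\ge0}$ be the jump times of $Z$ with $T_0=0$, $Y_n=Z(T_n)$, $S_n=(T_0,Y_0,\ldots,T_n,Y_n)$. For a realization $s_n=(0,1,t_1,y_1,\ldots,t_n,y_n)$ define the row vector $\alpha(s_n)=\pi_1(0)\prod_{\ell=0}^{n-1}\prod_{t_\ell}^{t_{\ell+1}}(I+M_{y_\ell y_\ell}(x)\,dx)M_{y_\ell y_{\ell+1}}(t_{\ell+1})$ (with $t_0=0$, $y_0=1$; for $n=0$, $\alpha(s_0)=\pi_1(0)$). *)

(* Defs.v *)
From HB Require Import structures.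
From mathcomp Require Import all_boot all_order all_algebra.
From mathcomp Require Import all_classical all_reals all_analysis.
Set Implicit Arguments. Unset Strict Implicit. Unset Printing Implicit Defensive.
Import Order.TTheory GRing.Theory Num.Theory.
Import numFieldNormedType.Exports.
Local Open Scope classical_set_scope.
Local Open Scope ring_scope.

Section AggregateMarkov.
Variable R : realType.

(* Macrostates are 'I_J.+1; the paper's macrostate 1 is ord0. *)
Variable J : nat.
Variable d : 'I_J.+1 -> nat.

Definition St := {j : 'I_J.+1 & 'I_(d j)}.

(* Product integral prod_t^s (I + A(x) dx) as the solution F t s of
   d/ds F t s = F t s * A s, F t t = I (matrices written entrywise). *)
Definition is_prodint (I : finType) (A : R -> I -> I -> R)
    (F : R -> R -> I -> I -> R) : Prop :=
  forall t : R,
    (forall i i', F t t i i' = (i == i')%:R) /\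
    (forall (s : R) (i i' : I),
        is_derive s 1 (fun u => F t u i i') (\sum_k F t s i k * A s k i')).

Definition rowmul (v : St -> R) (A : St -> St -> R) : St -> R :=
  fun e' => \sum_e v e * A e e'.

Definition blockM (M : R -> St -> St -> R) (j k : 'I_J.+1) (x : R) : St -> St -> R :=
  fun e e' => if (tag e == j) && (tag e' == k) then M x e e' else 0.

Definition step_path (T : Type) (x : R -> T) : Prop :=
  (forall t, 0 <= t -> exists2 eps, 0 < eps & forall u, t <= u < t + eps -> x u = x t) /\
  (forall t, 0 < t -> exists2 eps, 0 < eps & exists y, forall u, t - eps < u < t -> x u = y).

Definition leftval (z : R -> 'I_J.+1) (s : R) (j : 'I_J.+1) : Prop :=
  exists2 eps, 0 < eps & forall u, s - eps < u < s -> z u = j.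

Definition Ncount (z : R -> 'I_J.+1) (j k : 'I_J.+1) (t : R) : R :=
  \sum_(s \in [set s | 0 < s <= t /\ leftval z s j /\ z s = k]) (1 : R).

Fixpoint jt (z : R -> 'I_J.+1) (n : nat) : \bar R :=
  match n with
  | O => 0%E
  | n'.+1 =>
      match jt z n' with
      | r%:E => ereal_inf (EFin @` [set t | r < t /\ z t != z r])
      | _ => +oo%E
      end
  end.

Definition Tn (z : R -> 'I_J.+1) (n : nat) : R := fine (jt z n).
Definition Yn (z : R -> 'I_J.+1) (n : nat) : 'I_J.+1 := z (Tn z n).

Variables (M : R -> St -> St -> R) (pi0 : St -> R)
  (PI : 'I_J.+1 -> R -> R -> St -> St -> R).

(* alpha(S_n) as a function on E supported on macrostate Y_n:
   alpha(S_0) = pi_1(0),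
   alpha(S_{n+1}) = alpha(S_n) prod_{T_n}^{T_{n+1}}(I+M_{Y_n Y_n}) M_{Y_n Y_{n+1}}(T_{n+1}) *)
Fixpoint alpha (z : R -> 'I_J.+1) (n : nat) : St -> R :=
  match n with
  | O => pi0
  | n'.+1 =>
      rowmul (rowmul (alpha z n') (PI (Yn z n') (Tn z n') (Tn z n)))
             (blockM M (Yn z n') (Yn z n) (Tn z n))
  end.

Definition lam_term (z : R -> 'I_J.+1) (j k : 'I_J.+1) (t : R) (n : nat) : R :=
  if Yn z n == j then
    let v := rowmul (alpha z n) (PI j (Tn z n) t) in
    (\sum_(e | tag e == j) \sum_(e' | tag e' == k) v e * M t e e') /
    (\sum_(e | tag e == j) v e)
  else 0.

(* lambda_jk(t) = sum_n 1_{(T_n,T_{n+1}]}(t) (...): the intervals are disjoint,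
   so the sum is the term of the (unique) n with T_n < t <= T_{n+1}, or 0. *)
Definition lam (z : R -> 'I_J.+1) (j k : 'I_J.+1) (t : R) : R :=
  let P := [set n : nat | (jt z n < t%:E)%E /\ (t%:E <= jt z n.+1)%E] in
  if pselect (exists n, P n) is left _ then lam_term z j k t (xget 0%N P) else 0.

End AggregateMarkov.

Definition natfilt (R : realType) (Omega : Type) (T : Type)
    (W : R -> Omega -> T) (s : R) : set (set Omega) :=
  <<s [set A | exists u e, (0 <= u <= s)%R /\ A = [set w | W u w = e]] >>.

(* Main.v *)
Require Import Defs.
From HB Require Import structures.
From mathcomp Require Import all_boot all_order all_algebra.
From mathcomp Require Import all_classical all_reals all_analysis.
From mathcomp Require Import measurable_realfun ring lra.
Import Order.TTheory GRing.Theory Num.Theory.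
Import numFieldNormedType.Exports.
Local Open Scope classical_set_scope.
Local Open Scope ring_scope.
Set Implicit Arguments. Unset Strict Implicit. Unset Printing Implicit Defensive.

(* On a grid of mesh h, the conditional law of X given the sampled path of Z is an
   explicit matrix product of blocks of the transition matrices.  Dividing by h at every
   jump of the sampled path turns this product into an Euler scheme which, as h tends
   to 0, converges along every step path to alpha(S_n) prod_{T_n}^u (I + M_jj).
   Hence E[1_A 1_{X_u = e}] = E[1_A v_e / |v|] for A in F^Z_s, s < u, where v is that
   limit: the error made by replacing |v| with |v| + delta is at most delta times the
   total mass of the grid paths weighted by h^(number of jumps), and this mass is bounded
   uniformly in h, so no positivity of |v| is ever needed.
   Counting jumps on the grid and passing to the limit (dominated by the number of
   changes of X on the grid, which increases under refinement) shows that
   E[1_A (N_t - N_s)] is the integral over ]s, t] of sum P(A, X_u = e) M_u(e, e');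
   substituting the filter formula and exchanging integrals gives the theorem. *)

(** * Product integrals near the diagonal *)

(** The conditional law of X given Z would usually be derived from the joint density of the jump
    times. On a grid, finitely many path probabilities take its place, the Markov property alone
    computes them, and the powers of 1/h turn them back into densities. Only averages over Z matter,
    so a path along which |v| is small does harm only in proportion to its mass: with delta in the
    denominator, a grid path q contributes an error of at most delta h^(jumps of q). Extending paths
    by one step multiplies the total of these weights by at most 1 + (J+1)h, whence the bound (J+1)
    exp((J+1)u), free of h. The vector v at u depends on the path strictly before u, so the grid
    stops at u - h; taking s strictly below u leaves room to round the times that describe an event
    of F^Z_s up to grid points. The same pointwise limit gives nonnegativity and joint measurability
    of the filter, so measurability of the jump times is never established. *)

Lemma lebesgue_number (R : realType) (Q : R -> R -> Prop) (a b : R) :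
  (forall c, a <= c <= b -> exists2 eta, 0 < eta &
     forall x y, a <= x <= b -> `|x - c| < eta -> `|y - c| < eta -> Q x y) ->
  exists2 delta, 0 < delta & forall x y, a <= x <= b -> `|y - x| < delta -> Q x y.
Proof.
move=> hQ.
have cpt : near_covering `[a, b]%classic.
  by apply/compact_near_coveringP; exact: segment_compact.
(* The radius [r] is the parameter that tends to 0 from the right; quantifying [y] inside the
   property of [x] lets compactness produce one radius for all [x], while [y] may leave [a, b]. *)
have [|r /= r0 hr] := cpt _ (0:R)^'+
    (fun r x => a <= x <= b -> forall y, `|y - x| < r -> Q x y) _.
  move=> c; rewrite /= in_itv /= => /hQ[eta eta0 hc].
  near=> x r => /= xab y yx.
  have xc : `|x - c| < eta / 2.
    by rewrite distrC; near: x; apply: cvgr_dist_lt; rewrite ?divr_gt0//; exact: cvg_id.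
  have r2 : r < eta / 2 by near: r; apply: nbhs_right_lt; rewrite divr_gt0.
  apply: hc => //.
  rewrite -(subrK x y) -addrA (le_lt_trans (ler_normD _ _))//.
  by rewrite (splitr eta) ltrD//; exact: lt_trans r2.
exists (r / 2) => [|x y xab yx]; first by rewrite divr_gt0.
apply: (hr (r / 2)) => //=; rewrite ?divr_gt0 ?in_itv//.
by rewrite sub0r normrN ger0_norm ?divr_ge0 ?ltW// ltr_pdivrMr// ltr_pMr// ltr1n.
Unshelve. all: end_near. Qed.

Lemma uniform_continuity_itv (R : realType) (f : R -> R) (a b eps : R) :
  continuous f -> 0 < eps ->
  exists2 eta, 0 < eta &
    forall x y, a <= x <= b -> `|y - x| < eta -> `|f y - f x| <= eps.
Proof.
move=> cf eps0; apply: lebesgue_number => c _.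
have /cvgrPdist_lt/(_ (eps / 2)) := cf c.
rewrite divr_gt0// => /(_ isT) [eta /= eta0 h].
exists eta => // x y _ xc yc.
have hx := h x _; have hy := h y _; rewrite /= in hx hy.
rewrite distrC in xc; rewrite distrC in yc.
rewrite -(subrK (f c) (f y)) -addrA (le_trans (ler_normD _ _))//.
by rewrite (splitr eps) lerD// ltW// ?hx// distrC hy.
Qed.

Lemma fin_lower_bound (R : realType) (I : finType) (eta : I -> R) :
  (forall i, 0 < eta i) -> exists2 e, 0 < e & forall i, e <= eta i.
Proof.
move=> h; exists (1 + \sum_i (eta i)^-1)^-1.
  by rewrite invr_gt0 ltr_pwDl// sumr_ge0// => i _; rewrite invr_ge0 ltW.
move=> i; rewrite -[leRHS]invrK lef_pV2 ?posrE ?invr_gt0//; last first.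
  by rewrite ltr_pwDl// sumr_ge0// => j _; rewrite invr_ge0 ltW.
rewrite (bigD1 i)//= addrCA lerDl addr_ge0// sumr_ge0// => j _.
by rewrite invr_ge0 ltW.
Qed.

Lemma fin_uniform_continuity (R : realType) (I : finType) (f : I -> R -> R) (a b eps : R) :
  (forall i, continuous (f i)) -> 0 < eps ->
  exists2 eta, 0 < eta &
    forall i x y, a <= x <= b -> `|y - x| < eta -> `|f i y - f i x| <= eps.
Proof.
move=> cf eps0.
have h i := @uniform_continuity_itv _ (f i) a b eps (cf i) eps0.
pose eta i := sval (cid2 (h i)).
have [e e0 he] : exists2 e, 0 < e & forall i, e <= eta i.
  by apply: fin_lower_bound => i; rewrite /eta; case: cid2.
exists e => // i x y xab yx; have := he i; rewrite /eta; case: cid2 => /= z z0 hz ez.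
by apply: hz => //; exact: lt_le_trans ez.
Qed.

Lemma fin_bounded (R : realType) (I : finType) (f : I -> R -> R) (a b : R) :
  (forall i, continuous (f i)) ->
  exists2 c, 0 < c & forall i x, a <= x <= b -> `|f i x| <= c.
Proof.
move=> cf; have [ba|ab] := ltP b a.
  by exists 1 => // i x /andP[ax xb]; have := lt_le_trans (le_lt_trans xb ba) ax; rewrite ltxx.
have h i : exists c, forall x, a <= x <= b -> `|f i x| <= c.
  have [|c cab hc] := @EVT_max R (fun x => `|f i x|) a b ab.
    apply: continuous_subspaceT => x; apply: cvg_norm; apply: cf.
  by exists `|f i c| => x xab; apply: hc; rewrite in_itv.
pose c i := `|sval (cid (h i))|.
have c0 l : 0 <= c l by exact: normr_ge0.
exists (1 + \sum_i c i); first by rewrite ltr_pwDl ?sumr_ge0.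
move=> i x xab; rewrite (bigD1 i)//=.
have : `|f i x| <= c i by rewrite /c; case: cid => /= z /(_ _ xab) /le_trans; apply; exact: ler_norm.
by move=> /le_trans; apply; rewrite addrCA lerDl addr_ge0 ?sumr_ge0.
Qed.

Lemma is_derive_continuous (R : realType) (f df : R -> R) :
  (forall x : R, is_derive x 1 f (df x)) -> continuous f.
Proof.
move=> fdf x; apply: differentiable_continuous.
by apply/derivable1_diffP; have [] := fdf x.
Qed.

Lemma mean_value (R : realType) (f df : R -> R) (a b : R) :
  (forall x : R, is_derive x 1 f (df x)) -> a <= b ->
  exists2 c, a <= c <= b & f b - f a = df c * (b - a).
Proof.
move=> fdf ab; have [|c] := @MVT_segment R f df a b ab (fun x _ => fdf x).
  exact: continuous_subspaceT (is_derive_continuous fdf).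
by rewrite in_itv => cab fab; exists c.
Qed.

Section prodint.
Variables (R : realType) (I : finType) (A : R -> I -> I -> R) (F : R -> R -> I -> I -> R).
Hypothesis (Acont : forall i k, continuous (fun x => A x i k)).
Hypothesis hF : is_prodint A F.

Let F0 t i k : F t t i k = (i == k)%:R. Proof. exact: (hF t).1. Qed.
Let dF t i k (s : R) : is_derive s 1 (fun u => F t u i k) (\sum_l F t s i l * A s l k).
Proof. exact: (hF t).2. Qed.

Lemma prodint_continuous t i k : continuous (fun s => F t s i k).
Proof. exact: is_derive_continuous (dF t i k). Qed.

(* The largest entry B of the row attained on [t, s] satisfies B <= 1 + B / 2 by the mean
   value theorem. *)
Lemma prodint_local_bound (T c eta : R) : 0 <= c ->
  (forall i k x, 0 <= x <= T -> `|A x i k| <= c) ->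
  eta * (#|I|%:R * c) <= 2^-1 ->
  forall t s i k, 0 <= t -> t <= s -> s <= t + eta -> s <= T -> `|F t s i k| <= 2.
Proof.
move=> c0 hA heta t s i k t0 ts se sT.
have ct l : exists2 u, t <= u <= s & forall v, t <= v <= s -> `|F t v i l| <= `|F t u i l|.
  have [|u uts hu] := @EVT_max R (fun v => `|F t v i l|) t s ts.
    by apply: continuous_subspaceT => x; apply: cvg_norm; exact: prodint_continuous.
  exists u; first by rewrite in_itv in uts.
  by move=> v vts; apply: hu; rewrite in_itv.
pose u l := sval (cid2 (ct l)).
have hu l : t <= u l <= s by rewrite /u; case: cid2.
have hF' l v : t <= v <= s -> `|F t v i l| <= `|F t (u l) i l|.
  by rewrite /u; case: cid2 => /= x ? h /h.
pose m := [arg max_(l > k) `|F t (u l) i l|]%O.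
have hm l v : t <= v <= s -> `|F t v i l| <= `|F t (u m) i m|.
  move=> /hF'/le_trans; apply; rewrite /m; case: arg_maxP => // q _; exact.
set B := `|F t (u m) i m| in hm.
have /andP[tum ums] := hu m.
have [x /andP[tx xu] hx] := mean_value (dF t i m) tum.
suff B2 : B <= 1 + 2^-1 * B.
  by apply: (le_trans (hm k s _)); [rewrite ts/=|lra].
have B0 : 0 <= B by exact: normr_ge0.
have BE : B = `|(i == m)%:R + (F t (u m) i m - F t t i m)| by rewrite F0 addrC subrK.
rewrite [leLHS]BE (le_trans (ler_normD _ _))//; rewrite lerD//.
  by case: eqP => _; rewrite ?normr1 ?normr0.
rewrite hx normrM.
have h : `|\sum_l F t x i l * A x l m| <= #|I|%:R * (B * c).
  apply: (le_trans (ler_norm_sum _ _ _)); rewrite -sum1_card natr_sum mulr_suml; apply: ler_sum => l _.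
  rewrite mul1r normrM ler_pM//; first by apply: hm; rewrite tx/= (le_trans xu).
  by apply: hA; rewrite (le_trans t0)//= (le_trans xu)// (le_trans ums).
apply: (@le_trans _ _ ((#|I|%:R * (B * c)) * eta)).
  rewrite ler_pM// ger0_norm ?subr_ge0//; lra.
nra.
Qed.

(** Uniformity in the initial time [t] is the point: [is_prodint] says nothing on regularity in [t],
    so every constant has to come from a bound on [A] over [0, T]. *)
Lemma prodint_lipschitz (T : R) : exists2 C, 0 < C & exists2 eta, 0 < eta &
  forall t s i k, 0 <= t -> t <= s -> s <= T -> s - t <= eta ->
    `|F t s i k - (i == k)%:R| <= C * (s - t).
Proof.
have [c c0 hc] := @fin_bounded R (I * I)%type (fun p x => A x p.1 p.2) 0 T (fun p => @Acont p.1 p.2).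
have Ic : 0 < #|I|%:R * c + 1 by rewrite ltr_wpDl// mulr_ge0// ltW.
(* This [eta] meets the smallness condition of [prodint_local_bound], so entries of [F] stay below 2
   and the derivative below [#|I| * 2c]; the [+ 1] terms keep the constants positive. *)
pose eta := (2 * (#|I|%:R * c + 1))^-1.
have eta0 : 0 < eta by rewrite invr_gt0 mulr_gt0.
have etah : eta * (#|I|%:R * c) <= 2^-1.
  rewrite /eta invfM -mulrA ger_pMr ?invr_gt0// mulrC ler_pdivrMr// mul1r; lra.
exists (#|I|%:R * (2 * c) + 1).
  by rewrite ltr_wpDl// mulr_ge0// mulr_ge0// ltW.
exists eta => // t s i k t0 ts sT st.
have [x /andP[tx xs]] := mean_value (@dF t i k) ts.
rewrite F0 => ->; rewrite normrM [X in _ * X]ger0_norm ?subr_ge0// ler_wpM2r ?subr_ge0//.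
have h : `|\sum_l F t x i l * A x l k| <= #|I|%:R * (2 * c).
  apply: (le_trans (ler_norm_sum _ _ _)); rewrite -sum1_card natr_sum mulr_suml; apply: ler_sum => l _.
  rewrite mul1r normrM ler_pM//.
    apply: (@prodint_local_bound T c eta) => //; first exact: ltW.
    - by move=> a b y yT; apply: (hc (a, b)).
    - by rewrite -lerBlDl; lra.
    - exact: le_trans sT.
  by apply: (hc (l, k)); rewrite (le_trans t0)//= (le_trans xs).
by rewrite (le_trans h)// lerDl.
Qed.

Lemma prodint_first_order (T eps : R) : 0 < eps -> exists2 eta, 0 < eta &
  forall t s i k, 0 <= t -> t <= s -> s <= T -> s - t < eta ->
    `|F t s i k - (i == k)%:R - (s - t) * A t i k| <= eps * (s - t).
Proof.
move=> eps0.
have [c c0 hc] := @fin_bounded R (I * I)%type (fun p x => A x p.1 p.2) 0 T (fun p => @Acont p.1 p.2).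
have [C C0 [eta0 eta00 hC]] := prodint_lipschitz T.
have e20 : 0 < eps / 2 by rewrite divr_gt0.
have [eta1 eta10 hA] := @fin_uniform_continuity R (I * I)%type (fun p x => A x p.1 p.2) 0 T _
  (fun p => @Acont p.1 p.2) e20.
have K0 : 0 < 2 * (#|I|%:R * (C * c) + 1).
  by rewrite mulr_gt0// ltr_wpDl// mulr_ge0// ltW// mulr_gt0.
pose eta2 := eps / (2 * (#|I|%:R * (C * c) + 1)).
have eta20 : 0 < eta2 by rewrite divr_gt0.
exists (Num.min eta0 (Num.min eta1 eta2)) => [|t s i k t0 ts sT].
  by rewrite !lt_min eta00 eta10 eta20.
rewrite !lt_min => /and3P[st0 st1 st2].
have [x /andP[tx xs]] := mean_value (@dF t i k) ts.
rewrite F0 => ->; rewrite [X in `|_ - X|]mulrC -mulrBl normrM [X in _ * X]ger0_norm ?subr_ge0//.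
rewrite ler_wpM2r ?subr_ge0//.
(* Splitting the identity off [F]: the variation of [A] is small by uniform continuity, and the
   remaining [F - I] is of order [s - t] by [prodint_lipschitz]. *)
have -> : \sum_l F t x i l * A x l k - A t i k =
    (A x i k - A t i k) + \sum_l (F t x i l - (i == l)%:R) * A x l k.
  under [in RHS]eq_bigr do rewrite mulrBl.
  rewrite sumrB [X in _ = _ + (_ - X)](bigD1 i)//= eqxx mul1r.
  rewrite [X in _ + (_ - (_ + X))]big1 ?addr0; last first.
    by move=> l /negPf; rewrite eq_sym => ->; rewrite mul0r.
  lra.
apply: (le_trans (ler_normD _ _)); rewrite (splitr eps) lerD//.
  apply: (hA (i, k)); first by rewrite t0 (le_trans ts).
  rewrite ger0_norm ?subr_ge0//; apply: le_lt_trans st1; lra.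
have h : `|\sum_l (F t x i l - (i == l)%:R) * A x l k| <= #|I|%:R * (C * (s - t) * c).
  apply: (le_trans (ler_norm_sum _ _ _)); rewrite -sum1_card natr_sum mulr_suml; apply: ler_sum => l _.
  rewrite mul1r normrM ler_pM//.
    apply: (@le_trans _ _ (C * (x - t))); last by rewrite ler_pM2l//; lra.
    by apply: hC => //; [exact: le_trans sT|lra].
  by apply: (hc (l, k)); rewrite (le_trans t0)//= (le_trans xs).
apply: (le_trans h).
have : (s - t) * (2 * (#|I|%:R * (C * c) + 1)) <= eps.
  by rewrite -ler_pdivlMr//; exact: ltW.
have : 0 <= s - t by rewrite subr_ge0.
set n := #|I|%:R => ? ?; nra.
Qed.
End prodint.

Lemma first_order (R : realType) (I : finType) (f df : I -> R -> R) (a b eps : R) :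
  (forall i (x : R), is_derive x 1 (f i) (df i x)) -> (forall i, continuous (df i)) -> 0 < eps ->
  exists2 eta, 0 < eta & forall i x y, a <= x <= b -> x <= y -> y - x < eta ->
    `|f i y - f i x - (y - x) * df i x| <= eps * (y - x).
Proof.
move=> fdf cdf eps0.
have [eta eta0 he] := fin_uniform_continuity a b cdf eps0.
exists eta => // i x y xab xy yx.
have [c /andP[xc cy] ->] := mean_value (fdf i) xy.
rewrite [X in `|_ - X|]mulrC -mulrBl normrM [X in _ * X]ger0_norm ?subr_ge0//.
rewrite ler_wpM2r ?subr_ge0//; apply: he => //.
rewrite ger0_norm ?subr_ge0//; apply: le_lt_trans yx; lra.
Qed.

(** * Jumps of step paths *)

(* At most one jump between two points closer than [delta]. *)
Lemma step_path_mesh (R : realType) (T : Type) (z : R -> T) (t : R) : step_path z ->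
  exists2 delta, 0 < delta & forall x y, 0 <= x -> x < y -> y <= t -> y - x < delta ->
    exists2 tau, x < tau <= y &
      (forall u, x <= u < tau -> z u = z x) /\ (forall u, tau <= u <= y -> z u = z y).
Proof.
move=> [zr zl].
have [|delta d0 hd] := @lebesgue_number R (fun x y => x < y -> exists2 tau, x < tau <= y &
   (forall u, x <= u < tau -> z u = z x) /\ (forall u, tau <= u <= y -> z u = z y)) 0 t.
  move=> c /andP[c0 ct].
  have [e1 e10 h1] := zr c c0.
  (* Comparing two points to the left of [c], instead of naming a left value, makes the case [c = 0]
     vacuous. *)
  have [e2 e20 h2] : exists2 e, 0 < e & forall u v, 0 <= u -> 0 <= v -> c - e < u < c -> c - e < v < c -> z u = z v.
    move: c0; rewrite le_eqVlt => /predU1P[<-|/zl[e e0 [y hy]]].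
      by exists 1 => // u v u0 _ /andP[_ /(le_lt_trans u0)]; rewrite ltxx.
    by exists e => // u v _ _ uc vc; rewrite !hy.
  exists (Num.min e1 e2); first by rewrite lt_min e10.
  move=> x y /andP[x0 _]; rewrite !ltr_norml !lt_min => /andP[xl /andP[xc1 xc2]] /andP[yl /andP[yc1 yc2]] xy.
  have m1 : Num.min e1 e2 <= e1 by rewrite ge_min lexx.
  have m2 : Num.min e1 e2 <= e2 by rewrite ge_min lexx orbT.
  have [yc|cy] := ltP y c.
    exists y; first by rewrite xy lexx.
    split=> u /andP[ul ur]; last by congr z; apply/eqP; rewrite eq_le ul ur.
    apply: h2; [lra|lra|apply/andP; split; lra|apply/andP; split; lra].
  have [xc|cx] := ltP x c.
    exists c; first by rewrite xc.
    split=> u /andP[ul ur].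
      apply: h2; [lra|lra|apply/andP; split; lra|apply/andP; split; lra].
    by rewrite !h1//; apply/andP; split; lra.
  exists y; first by rewrite xy lexx.
  by split=> u /andP[ul ur]; rewrite !h1//; apply/andP; split; lra.
exists delta => // x y x0 xy yt yx; apply: hd => //; first by rewrite x0 ltW// (lt_le_trans xy).
by rewrite ger0_norm// subr_ge0 ltW.
Qed.

Lemma step_path_comp (R : realType) (T U : Type) (f : T -> U) (x : R -> T) :
  step_path x -> step_path (fun u => f (x u)).
Proof.
move=> [hr hl]; split=> t t0.
  by have [e e0 he] := hr t t0; exists e => // u /he ->.
by have [e e0 [y he]] := hl t t0; exists e => //; exists (f y) => u /he ->.
Qed.

Definition grid (R : realType) (s h : R) (i : nat) : R := s + i%:R * h.

Lemma grid0 (R : realType) (s h : R) : grid s h 0 = s. Proof. by rewrite /grid mul0r addr0. Qed.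

Lemma gridS (R : realType) (s h : R) i : grid s h i.+1 = grid s h i + h.
Proof. by rewrite /grid -natr1 mulrDl mul1r addrA. Qed.

Lemma grid_le (R : realType) (s h : R) (i i' : nat) : 0 <= h -> (i <= i')%N ->
  grid s h i <= grid s h i'.
Proof. by move=> h0 ii; rewrite /grid lerD2l ler_wpM2r// ler_nat. Qed.

Lemma pow2_cvg0 (R : realType) (c : R) : (fun n => c / 2 ^+ n) @ \oo --> 0.
Proof.
rewrite -[0](mulr0 c); apply: cvgMr.
have := @cvg_geometric R 1 2^-1; under eq_cvg do rewrite /geometric/= mul1r exprVn.
by apply; rewrite ger0_norm// invf_lt1// ltr1n.
Qed.

Section jump_count.
Variables (R : realType) (J : nat) (z : R -> 'I_J.+1) (j k : 'I_J.+1).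
Hypotheses (zstep : step_path z) (jk : j != k).

Definition jumps (t : R) := [set s | 0 < s <= t /\ leftval z s j /\ z s = k].

Lemma jumps_step (x y tau : R) : 0 <= x -> x < tau <= y ->
  (forall u, x <= u < tau -> z u = z x) -> (forall u, tau <= u <= y -> z u = z y) ->
  jumps y = jumps x `|` (if (z x == j) && (z y == k) then [set tau] else set0).
Proof.
move=> x0 /andP[xt ty] hl hr.
have xy : x < y by exact: lt_le_trans ty.
rewrite eqEsubset; split=> s /=.
  move=> [/andP[s0 sy] [[e e0 he] sk]].
  have [sx|xs] := leP s x; first by left; rewrite /jumps/= s0 sx; split => //; split => //; exists e.
  right.
  (* Points just left of [s] have state [j]. If [s] is not [tau], some of them share the constancy
     interval of [s], where the state is [k], contradicting [jk]. *)
  have h v : v < s -> exists2 u, v <= u < s & s - e < u < s.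
    move=> vs; exists (Num.max v (s - e / 2)).
      by rewrite le_max lexx/= gt_max vs/=; lra.
    by rewrite lt_max gt_max vs/=; apply/andP; split; [apply/orP; right; lra|lra].
  have [st|ts|ts] := ltgtP s tau.
  - have [u /andP[xu us] /he uj] := h _ xs.
    have : z s = z u by rewrite !hl//; apply/andP; split; lra.
    by rewrite sk uj => kj; move: jk; rewrite kj eqxx.
  - have [u /andP[xu us] /he uj] := h _ ts.
    have : z s = z u by rewrite !hr//; apply/andP; split; lra.
    by rewrite sk uj => kj; move: jk; rewrite kj eqxx.
  - have [u /andP[xu us] /he uj] := h _ xs.
    have -> : z x = j by rewrite -uj hl//; apply/andP; split; lra.
    have -> : z y = k by rewrite -sk hr//; apply/andP; split; lra.
    by rewrite !eqxx.
move=> [[/andP[s0 sx] hs]|].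
  by split => //; rewrite s0 (le_trans sx)// ltW.
case: ifPn => // /andP[/eqP zx /eqP zy] -> {s}.
split; first by rewrite ty (le_lt_trans x0).
split; last by rewrite hr ?lexx.
exists (tau - x); first by rewrite subr_gt0.
by move=> u /andP[xu ut]; rewrite hl ?zx// ut andbT ltW//; lra.
Qed.

(** [Ncount] is a finite-support sum, worth 0 on an infinite jump set; finiteness must therefore be
    carried along with the value. *)
Lemma Ncount_step (x y tau : R) : 0 <= x -> x < tau <= y ->
  (forall u, x <= u < tau -> z u = z x) -> (forall u, tau <= u <= y -> z u = z y) ->
  finite_set (jumps x) ->
  finite_set (jumps y) /\ Ncount z j k y = Ncount z j k x + ((z x == j) && (z y == k))%:R.
Proof.
move=> x0 xty hl hr fx; have /= E := jumps_step x0 xty hl hr.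
have F : finite_set (if (z x == j) && (z y == k) then [set tau] else set0).
  by case: ifP => _; [exact: finite_set1|exact: finite_set0].
split; first by rewrite E finite_setU.
rewrite /Ncount -/(jumps y) -/(jumps x) E fsbigU0//=.
  by case: ifP => _; rewrite ?fsbig_set1 ?fsbig_set0.
case: ifP => _ s [] //= [/andP[_ sx] _] st; move: xty; rewrite -st => /andP[].
by rewrite ltNge sx.
Qed.

Lemma Ncount_grid (s t : R) : 0 <= s -> finite_set (jumps s) ->
  exists2 delta, 0 < delta & forall h i, 0 < h < delta -> grid s h i <= t ->
   finite_set (jumps (grid s h i)) /\ Ncount z j k (grid s h i) = Ncount z j k s +
   \sum_(a < i) ((z (grid s h a) == j) && (z (grid s h a.+1) == k))%:R.
Proof.
move=> s0 fs; have [delta d0 hd] := step_path_mesh t zstep.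
exists delta => // h i /andP[h0 hdelta]; elim: i => [|i IH].
  by rewrite grid0 big_ord0 addr0.
move=> it; have it' : grid s h i <= t by apply: le_trans it; rewrite gridS lerDl ltW.
have [f e] := IH it'.
have gi0 : 0 <= grid s h i by rewrite /grid addr_ge0// mulr_ge0// ltW.
have lti : grid s h i < grid s h i.+1 by rewrite gridS ltrDl.
have [|tau xty [hl hr]] := hd _ _ gi0 lti it; first by rewrite gridS; lra.
have [f' e'] := Ncount_step gi0 xty hl hr f.
by rewrite big_ord_recr/= e' e addrA.
Qed.

Lemma finite_jumps (t : R) : finite_set (jumps t).
Proof.
have [t0|t0] := leP t 0.
  rewrite (_ : jumps t = set0); first exact: finite_set0.
  by rewrite -subset0 => s [/andP[s0 st] _]; have := lt_le_trans s0 (le_trans st t0); rewrite ltxx.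
have f0 : finite_set (jumps 0).
  rewrite (_ : jumps 0 = set0); first exact: finite_set0.
  by rewrite -subset0 => s [/andP[s0 st] _]; have := lt_le_trans s0 st; rewrite ltxx.
have [delta d0 hd] := @Ncount_grid 0 t (lexx _) f0.
pose n := (Num.truncn (t / delta)).+1.
have n0 : (0 : R) < n%:R by rewrite ltr0n.
have E : grid 0 (t / n%:R) n = t by rewrite /grid add0r mulrC divfK// gt_eqF.
have [||+ _] := hd (t / n%:R) n; rewrite ?E//.
rewrite divr_gt0//= ltr_pdivrMr// mulrC -ltr_pdivrMr//.
by have /andP[] := truncn_itv (ltW (divr_gt0 t0 d0)).
Qed.

Lemma Ncount0 : Ncount z j k 0 = 0.
Proof.
rewrite /Ncount (_ : [set s | _] = set0) ?fsbig_set0//.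
by rewrite -subset0 => s [/andP[s0 st] _]; have := lt_le_trans s0 st; rewrite ltxx.
Qed.

(** Once the mesh is below that of [step_path_mesh], no cell hides two jumps, so sampling loses
    nothing. *)
Lemma Ncount_cvg (s t : R) : 0 <= s -> s < t ->
  \forall n \near \oo,
   \sum_(a < 2 ^ n) ((z (grid s ((t - s) / 2 ^+ n) a) == j) && (z (grid s ((t - s) / 2 ^+ n) a.+1) == k))%:R =
   Ncount z j k t - Ncount z j k s.
Proof.
move=> s0 st; have [delta d0 hd] := Ncount_grid t s0 (finite_jumps s).
have /cvgrPdist_lt/(_ _ d0) := pow2_cvg0 (t - s).
apply: filterS => n; rewrite sub0r normrN => h.
have h0 : 0 < (t - s) / 2 ^+ n by rewrite divr_gt0 ?subr_gt0 ?exprn_gt0.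
have E : grid s ((t - s) / 2 ^+ n) (2 ^ n) = t.
  by rewrite /grid natrX mulrC divfK ?expf_neq0 ?pnatr_eq0// addrC subrK.
have hn : (t - s) / 2 ^+ n < delta by rewrite -(gtr0_norm h0).
have [||_] := hd ((t - s) / 2 ^+ n) (2 ^ n)%N; rewrite ?E ?h0//.
by move=> ->; rewrite addrAC subrr add0r.
Qed.
End jump_count.

(** * Jump times: the infimum is attained and there is no accumulation *)

Section jump_times.
Variables (R : realType) (J : nat) (z : R -> 'I_J.+1).
Hypothesis (zstep : step_path z).

(** All three facts come from right-continuity: constancy of the path just after [r], or just after
    an [r'] with [z r' = z r], pushes the infimum further right. *)
Lemma jt_next (n : nat) (r : R) : jt z n = r%:E -> 0 <= r ->
  [/\ (r%:E < jt z n.+1)%E,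
      forall t, r <= t -> (t%:E < jt z n.+1)%E -> z t = z r &
      forall r', jt z n.+1 = r'%:E -> z r' != z r].
Proof.
move=> jn r0; have /= -> : jt z n.+1 = ereal_inf (EFin @` [set t | r < t /\ z t != z r]).
  by rewrite /= jn.
set S := [set t | _].
have lbS t : S t -> (ereal_inf (EFin @` S) <= t%:E)%E.
  by move=> St; apply: ereal_inf_lbound; exists t.
have const t : r <= t -> (t%:E < ereal_inf (EFin @` S))%E -> z t = z r.
  rewrite le_eqVlt => /predU1P[->//|rt] tS; apply/eqP; apply: contraT => zt.
  by have := lt_le_trans tS (lbS t (conj rt zt)); rewrite ltxx.
split => //.
  have [e e0 he] := zstep.1 r r0.
  apply: (@lt_le_trans _ _ (r + e)%:E); first by rewrite lte_fin ltrDl.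
  apply: le_ereal_inf_tmp => _ [t [rt zt] <-]; rewrite lee_fin leNgt; apply/negP => te.
  by move: zt; rewrite he ?eqxx// te ltW.
move=> r' hr'; apply/negP => /eqP zr'.
have rr' : r <= r'.
  by rewrite -lee_fin -hr'; apply: le_ereal_inf_tmp => _ [t [rt zt] <-]; rewrite lee_fin ltW.
have [e e0 he] := zstep.1 r' (le_trans r0 rr').
suff : ((r' + e)%:E <= r'%:E)%E by rewrite lee_fin gerDl leNgt e0.
rewrite -hr'; apply: le_ereal_inf_tmp => _ [t [rt zt] <-]; rewrite lee_fin leNgt; apply/negP => te.
have r't : r' <= t by rewrite -lee_fin -hr'; exact: lbS.
by move: zt; rewrite he ?r't// zr' eqxx.
Qed.

Lemma jt_ge0 (n : nat) : (0%:E <= jt z n)%E.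
Proof.
elim: n => [|n IH] //.
case jn : (jt z n) IH => [r| |] //; rewrite [jt z n.+1]/= jn // lee_fin => r0.
 apply: le_ereal_inf_tmp => _ [t [rt zt] <-].
by rewrite lee_fin (le_trans r0)// ltW.
Qed.

Lemma jt_exists (u : R) : 0 < u -> exists n, ((jt z n < u%:E)%E /\ (u%:E <= jt z n.+1)%E).
Proof.
move=> u0; have [H|] := pselect (exists m, (u%:E <= jt z m)%E).
  case: (ex_minnP H) => -[|m] um hmin; first by move: um; rewrite /= lee_fin leNgt u0.
  by exists m; split => //; rewrite ltNge; apply/negP => /hmin; rewrite ltnn.
move=> /forallNP h; exfalso.
have jtu m : (jt z m < u%:E)%E by rewrite ltNge; exact/negP/h.
pose r m := fine (jt z m).
have jr m : jt z m = (r m)%:E.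
  by rewrite /r fineK// ge0_fin_numE ?jt_ge0// (lt_trans (jtu m)) ?ltry.
have r0 m : 0 <= r m by rewrite -lee_fin -jr; exact: jt_ge0.
have ru m : r m < u by rewrite -lte_fin -jr.
have rS m : r m < r m.+1 by have [+ _ _] := jt_next (jr m) (r0 m); rewrite jr lte_fin.
have rc m t : r m <= t -> t < r m.+1 -> z t = z (r m).
  by move=> mt tm; have [_ h' _] := jt_next (jr m) (r0 m); apply: h'; rewrite // jr lte_fin.
have rn m : z (r m.+1) != z (r m) by have [_ _] := jt_next (jr m) (r0 m); apply; rewrite jr.
have [delta d0 hd] := step_path_mesh u zstep.
(* Two consecutive jumps cannot fit in a window shorter than [delta], which has a single switching
   point. Hence [r m.*2] grows linearly and passes [u]. *)
have far m : r m + delta <= r m.+2.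
  rewrite leNgt; apply/negP => lt2.
  have [|tau /andP[t1 t2] [hl hr]] := hd _ _ (r0 m) (lt_trans (rS m) (rS m.+1)) (ltW (ru _)); first by lra.
  have [rt|tr] := ltP (r m.+1) tau.
    by have /eqP := rn m; apply; apply: hl; rewrite rt ltW ?rS.
  by have /eqP := rn m.+1; apply; apply/esym; apply: hr; rewrite tr ltW ?rS.
have lin m : m%:R * delta <= r m.*2.
  elim: m => [|m IH]; first by rewrite mul0r.
  by rewrite -natr1 mulrDl mul1r doubleS (le_trans _ (far _))// lerD2r.
have := lin (Num.truncn (u / delta)).+1; rewrite leNgt => /negP; apply.
rewrite (lt_trans (ru _))// -ltr_pdivrMr//.
by have /andP[] := truncn_itv (ltW (divr_gt0 u0 d0)).
Qed.

End jump_times.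

(** * The filter along a grid *)

Lemma small_factor (R : realType) (K eps : R) : 0 <= K -> 0 < eps ->
  exists2 e, 0 < e <= 1 & K * e <= eps.
Proof.
move=> K0 eps0; have K1 : 0 < K + 1 by rewrite ltr_wpDl.
exists (Num.min 1 (eps / (K + 1))); first by rewrite lt_min ltr01 divr_gt0//= ge_min lexx.
apply: (@le_trans _ _ (K * (eps / (K + 1)))); first by rewrite ler_wpM2l// ge_min lexx orbT.
by rewrite mulrCA ger_pMr// ler_pdivrMr// mul1r lerDl.
Qed.

Lemma discrete_gronwall (R : realType) (D : nat -> R) (K h eps : R) (l : nat) :
  0 <= K -> 0 <= h -> 0 <= eps -> 0 <= D 0%N ->
  (forall i, (i < l)%N -> D i.+1 <= (1 + K * h) * D i + eps * h) ->
  D l <= (D 0%N + eps * (l%:R * h)) * expR (K * (l%:R * h)).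
Proof.
move=> K0 h0 eps0 D0; elim: l => [|l IH] hD.
  by rewrite mul0r !mulr0 addr0 expR0 mulr1.
have {}IH := IH (fun i il => hD i (ltnW il)).
have Kh : 1 <= 1 + K * h by rewrite lerDl mulr_ge0.
apply: (le_trans (hD l (ltnSn l))).
have e1 : 1 + K * h <= expR (K * h) by exact: expR_ge1Dx.
have E : expR (K * (l.+1%:R * h)) = expR (K * h) * expR (K * (l%:R * h)).
  by rewrite -expRD -natr1; congr expR; rewrite mulrDl mul1r mulrDr addrC.
set x := expR (K * (l%:R * h)) in IH E *.
have x1 : 1 <= x by rewrite -expR0 ler_expR// mulr_ge0// mulr_ge0.
set y := expR (K * h) in e1 E.
have S0 : 0 <= D 0%N + eps * (l%:R * h) by rewrite addr_ge0// !mulr_ge0.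
have -> : D 0%N + eps * (l.+1%:R * h) = D 0%N + eps * (l%:R * h) + eps * h.
  by rewrite -natr1 mulrDl mul1r mulrDr addrA.
rewrite E.
set S := D 0%N + _ in IH S0 *.
rewrite [leRHS]mulrDl lerD//.
  rewrite mulrCA; apply: (@le_trans _ _ ((1 + K * h) * (S * x))).
    by rewrite ler_wpM2l// (le_trans _ Kh).
  by rewrite ler_wpM2r// mulr_ge0// (le_trans _ x1).
rewrite ler_peMr ?mulr_ge0//.
by rewrite -[1]mulr1 ler_pM// (le_trans Kh).
Qed.

Lemma grid_ceil (R : realType) (h r : R) : 0 < h -> 0 <= r ->
  exists i, r <= grid 0 h i < r + h.
Proof.
move=> h0 r0; have /andP[] := truncn_itv (divr_ge0 r0 (ltW h0)).
set m := Num.truncn _; rewrite ler_pdivlMr// ltr_pdivrMr// => m1 m2.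
have [E|E] := eqVneq (m%:R * h) r.
  by exists m; rewrite /grid add0r E lexx ltrDl.
exists m.+1; rewrite /grid add0r ltW//= -natr1 mulrDl mul1r ltrD2r lt_neqAle E//.
Qed.

Lemma cvg_rsum (R : realType) (I T : Type) (F : set_system T) (r : seq I) (P : pred I)
    (f : I -> T -> R) (l : I -> R) {FF : Filter F} :
  (forall i, P i -> f i x @[x --> F] --> l i) ->
  \sum_(i <- r | P i) f i x @[x --> F] --> \sum_(i <- r | P i) l i.
Proof. by move=> h; apply: cvg_big => //; exact: add_continuous. Qed.

Lemma is_derive_fsum (R : realType) (I : finType) (f : I -> R -> R) (df : I -> R) (x : R) :
  (forall i, is_derive x 1 (f i) (df i)) ->
  is_derive x 1 (fun s => \sum_i f i s) (\sum_i df i).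
Proof.
move=> h; rewrite (_ : (fun s => _) = \sum_i f i); last by apply/funext => s; rewrite fct_sumE.
by elim/big_ind2 : _ => // [|f1 d1 f2 d2]; [exact: is_derive_cst|exact: is_deriveD].
Qed.

Lemma is_derive_scale (R : realType) (a : R) (f : R -> R) (df : R) (x : R) :
  is_derive x 1 f df -> is_derive x 1 (fun s => a * f s) (a * df).
Proof. by move=> h; exact: (@is_deriveZ R R R f a x 1 df h). Qed.

Section discrete_filter.
Variables (R : realType) (J : nat) (d : 'I_J.+1 -> nat).
Variables (M : R -> St d -> St d -> R) (Ptr : R -> R -> St d -> St d -> R).
Variables (PI : 'I_J.+1 -> R -> R -> St d -> St d -> R) (pi0 : St d -> R).

Definition jump_scale (h : R) (y y' : 'I_J.+1) : R := if y == y' then 1 else h^-1.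

(* [q] lists the states of Z at the grid points 0, h, 2h, ..., latest first.  The value at [e]
   is P(path = q, X = e) divided by the power of [h] counting the jumps of [q]; see
   [path_prob]. *)
Fixpoint dfilter (h : R) (q : seq 'I_J.+1) : St d -> R :=
  match q with
  | [::] => fun=> 0
  | y :: q' =>
    match q' with
    | [::] => fun e => if tag e == y then pi0 e else 0
    | y' :: _ => fun e' => if tag e' == y then
        (\sum_e dfilter h q' e * Ptr (grid 0 h (size q').-1) (grid 0 h (size q')) e e')
          * jump_scale h y' y else 0
    end
  end.

Fixpoint grid_path (z : R -> 'I_J.+1) (h : R) (i : nat) : seq 'I_J.+1 :=
  match i with
  | O => [:: z 0]
  | i'.+1 => z (grid 0 h i) :: grid_path z h i'
  end.

Lemma size_grid_path z h i : size (grid_path z h i) = i.+1.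
Proof. by elim: i => //= i ->. Qed.

Lemma grid_pathE z h i : exists q, grid_path z h i = z (grid 0 h i) :: q.
Proof. by case: i => [|i]; [exists [::]; rewrite /= grid0|exists (grid_path z h i)]. Qed.

Lemma dfilter_cons h y y' q e' : dfilter h (y :: y' :: q) e' = if tag e' == y then
  (\sum_e dfilter h (y' :: q) e * Ptr (grid 0 h (size q)) (grid 0 h (size q).+1) e e')
          * jump_scale h y' y else 0.
Proof. by []. Qed.

Lemma dfilterS z h i e' : dfilter h (grid_path z h i.+1) e' =
  if tag e' == z (grid 0 h i.+1) then
  (\sum_e dfilter h (grid_path z h i) e * Ptr (grid 0 h i) (grid 0 h i.+1) e e')
          * jump_scale h (z (grid 0 h i)) (z (grid 0 h i.+1)) else 0.
Proof.
have [q E] := grid_pathE z h i; have := size_grid_path z h i.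
by rewrite [grid_path _ _ i.+1]/= E => -[<-]; rewrite dfilter_cons.
Qed.

Lemma dfilter_supp h y q e : tag e != y -> dfilter h (y :: q) e = 0.
Proof. by case: q => [|y' q] /negPf; rewrite /= => ->. Qed.

(* The row vector alpha(S_n) prod_{T_n}^u (I + M) with n chosen by T_n < u <= T_{n+1}, as in
   [lam]; it is cut off to the current macrostate because alpha(S_0) = pi0 is not supported
   there when Z_0 is not the initial macrostate. *)
Definition filter_num (z : R -> 'I_J.+1) (u : R) (e : St d) : R :=
  let n := xget 0%N [set n : nat | (jt z n < u%:E)%E /\ (u%:E <= jt z n.+1)%E] in
  if tag e == Yn z n then rowmul (alpha M pi0 PI z n) (PI (Yn z n) (Tn z n) u) e else 0.

Hypotheses (Mcont : forall e e', continuous (fun x => M x e e'))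
  (hPtr : is_prodint M Ptr) (hPI : forall j, is_prodint (blockM M j j) (PI j)).

Section fixed_path.
Variables (z : R -> 'I_J.+1) (zstep : step_path z).

Let alp m e := if tag e == Yn z m then alpha M pi0 PI z m e else 0.
(** The formula of the m-th interval, kept for every [s] and not only between the two jumps, so that
    it is differentiable everywhere and the uniform estimates on [0, u] apply to it. *)
Let w m (e : St d) (s : R) :=
  if tag e == Yn z m then rowmul (alpha M pi0 PI z m) (PI (Yn z m) (Tn z m) s) e else 0.
Let dw m (e : St d) (s : R) :=
  if tag e == Yn z m then \sum_k w m k s * M s k e else 0.

Let w0 m e : w m e (Tn z m) = alp m e.
Proof.
rewrite /w /alp; case: ifP => // _; rewrite /rowmul (bigD1 e)//= (hPI _ _).1 eqxx mulr1.
by rewrite big1 ?addr0// => i /negPf ie; rewrite (hPI _ _).1 ie mulr0.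
Qed.

Let w_derive m e (s : R) : is_derive s 1 (w m e) (dw m e s).
Proof.
rewrite /w /dw; case: ifP => te; last exact: is_derive_cst.
rewrite /rowmul; set a := alpha _ _ _ _ _; set r := Tn z m; set y := Yn z m.
have -> : \sum_k w m k s * M s k e =
    \sum_e' a e' * (\sum_k PI y r s e' k * blockM M y y s k e).
  under [RHS]eq_bigr do rewrite mulr_sumr.
  rewrite exchange_big/=; apply: eq_bigr => k _; rewrite /w /rowmul -/a -/r -/y.
  under eq_bigr do rewrite mulrA.
  by rewrite -mulr_suml /blockM te andbT; case: ifP => _; rewrite ?mul0r ?mulr0.
by apply: is_derive_fsum => e'; apply: is_derive_scale; exact: (hPI _ _).2.
Qed.

Let w_cont m e : continuous (w m e).
Proof. exact: is_derive_continuous (w_derive m e). Qed.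

Let dw_cont m e : continuous (dw m e).
Proof.
rewrite /dw; case: (tag e == _) => x; last exact: cvg_cst.
apply: (@cvg_rsum R _ _ _ _ xpredT (fun k s => w m k s * M s k e) (fun k => w m k x * M x k e)) => k _; apply: cvgM; [exact: w_cont|exact: Mcont].
Qed.

Let w_supp m e s : tag e != Yn z m -> w m e s = 0.
Proof. by rewrite /w => /negPf ->. Qed.

(** Stability and consistency of the Euler scheme between two jumps. The end of the step stays
    strictly below [u], since [u] may itself be the next jump time. *)
Let filter_step m (u : R) : jt z m = (Tn z m)%:E -> (u%:E <= jt z m.+1)%E -> Tn z m < u ->
  exists2 K, 0 <= K & forall eps, 0 < eps -> exists2 eta, 0 < eta & forall h i, 0 < h < eta ->
    Tn z m <= grid 0 h i -> grid 0 h i.+1 < u ->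
    \sum_e `|dfilter h (grid_path z h i.+1) e - w m e (grid 0 h i.+1)| <=
    (1 + K * h) * \sum_e `|dfilter h (grid_path z h i) e - w m e (grid 0 h i)| + eps * h.
Proof.
move=> jm um ru.
have r0 : 0 <= Tn z m by rewrite -lee_fin -jm; exact: jt_ge0.
set r := Tn z m in jm ru r0 *.
have zr s : r <= s -> s < u -> z s = Yn z m.
  move=> rs su; have [_ h _] := jt_next zstep jm r0; apply: h => //.
  by apply: lt_le_trans um; rewrite lte_fin.
have [W W0 hW] := @fin_bounded _ _ (w m) 0 u (fun e => @w_cont m e).
set n : R := #|{: St d}|%:R.
have n0 : 0 <= n by exact: ler0n.
have [C C0 [e3 e30 h3]] := prodint_lipschitz Mcont hPtr u.
exists (n * C) => [|eps eps0]; first by rewrite mulr_ge0// ltW.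
have [eps' /andP[eps'0 _] heps] : exists2 e, 0 < e <= 1 & n * (n * W + 1) * e <= eps.
  by apply: small_factor => //; rewrite mulr_ge0// addr_ge0// mulr_ge0// ltW.
have [e1 e10 h1] := first_order 0 u (w_derive m) (fun e => @dw_cont m e) eps'0.
have [e2 e20 h2] := prodint_first_order Mcont hPtr u eps'0.
exists (Num.min e1 (Num.min e2 e3)); first by rewrite !lt_min e10 e20 e30.
move=> h i /andP[h0]; rewrite !lt_min => /and3P[he1 he2 he3] ri iu.
set t := grid 0 h i in ri *; set t' := grid 0 h i.+1 in iu *.
have tt' : t' = t + h by rewrite /t' gridS.
have t0 : 0 <= t by exact: le_trans ri.
have tu : t < u by apply: le_lt_trans iu; rewrite tt' lerDl ltW.
have zt : z t = Yn z m by exact: zr.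
have zt' : z t' = Yn z m by apply: zr => //; rewrite tt' (le_trans ri)// lerDl ltW.
set V := dfilter h (grid_path z h i).
set D := \sum_e `|V e - w m e t|.
have Dle e' : `|dfilter h (grid_path z h i.+1) e' - w m e' t'| <=
    \sum_e `|V e - w m e t| * ((e == e')%:R + C * h) + (n * W + 1) * eps' * h.
  have rhs0 : 0 <= \sum_e `|V e - w m e t| * ((e == e')%:R + C * h) + (n * W + 1) * eps' * h.
    rewrite addr_ge0//; last by rewrite !mulr_ge0 ?addr_ge0 ?mulr_ge0// ltW.
    by apply: sumr_ge0 => e _; rewrite mulr_ge0// addr_ge0// mulr_ge0// ltW.
  rewrite dfilterS -/t -/t' zt zt' /jump_scale eqxx mulr1; case: ifPn => te'; last first.
    by rewrite w_supp// subrr normr0.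
  (* The previous error carried along by [Ptr], then the remainders of the first-order expansions of
     [Ptr] and of [w]; the linear terms cancel because [dw] is the product of [w] with [M] on the
     current block. *)
  have -> : \sum_e V e * Ptr t t' e e' - w m e' t' =
     \sum_e (V e - w m e t) * Ptr t t' e e' +
     (\sum_e w m e t * (Ptr t t' e e' - (e == e')%:R - (t' - t) * M t e e') -
      (w m e' t' - w m e' t - (t' - t) * dw m e' t)).
    have E1 : \sum_e (V e - w m e t) * Ptr t t' e e' =
        \sum_e V e * Ptr t t' e e' - \sum_e w m e t * Ptr t t' e e'.
      by rewrite -sumrB; apply: eq_bigr => e _; rewrite mulrBl.
    have E2 : \sum_e w m e t * (Ptr t t' e e' - (e == e')%:R - (t' - t) * M t e e') =
        \sum_e w m e t * Ptr t t' e e' - w m e' t - (t' - t) * dw m e' t.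
      rewrite /dw te' mulr_sumr.
      rewrite [X in _ = _ - X - _](_ : w m e' t = \sum_e w m e t * (e == e')%:R).
        by rewrite -!sumrB; apply: eq_bigr => e _; rewrite !mulrBr; congr (_ - _); rewrite mulrCA.
      by rewrite (bigD1 e')//= eqxx mulr1 big1 ?addr0// => e /negPf ->; rewrite mulr0.
    by rewrite E1 E2; lra.
  apply: (le_trans (ler_normD _ _)); rewrite lerD//.
    apply: (le_trans (ler_norm_sum _ _ _)); apply: ler_sum => e _; rewrite normrM ler_wpM2l//.
    rewrite -[Ptr _ _ _ _](subrK (e == e')%:R) addrC (le_trans (ler_normD _ _))// lerD//.
      by case: eqP; rewrite ?normr1 ?normr0.
    have -> : h = t' - t by rewrite tt'; lra.
    by apply: h3 => //; rewrite ?(ltW iu)// tt'; lra.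
  have tt'h : t' - t = h by rewrite tt'; lra.
  rewrite [(n * W + 1) * eps']mulrDl [(_ + _) * h]mulrDl mul1r; apply: (le_trans (ler_normB _ _)); rewrite lerD//.
    apply: (le_trans (ler_norm_sum _ _ _)).
    rewrite /n -sum1_card natr_sum !mulr_suml; apply: ler_sum => e _.
    rewrite mul1r normrM -mulrA ler_pM//; first by apply: hW; rewrite t0 ltW.
    by rewrite -tt'h; apply: h2; rewrite ?(ltW iu)//; lra.
  by rewrite -tt'h; apply: h1; rewrite ?t0 ?(ltW tu)//; lra.
apply: (@le_trans _ _ (\sum_e' (\sum_e `|V e - w m e t| * ((e == e')%:R + C * h) + (n * W + 1) * eps' * h))).
  by apply: ler_sum => e' _; exact: Dle.
rewrite big_split/= exchange_big/= lerD//.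
  rewrite mulr_sumr; apply: ler_sum => e _; rewrite -mulr_sumr mulrC ler_wpM2r//.
  rewrite big_split/= lerD//.
    by rewrite (bigD1 e)//= eqxx big1 ?addr0// => e' /negPf; rewrite eq_sym => ->.
  by rewrite sumr_const -mulrA mulr_natl.
by rewrite sumr_const -mulr_natl !mulrA ler_wpM2r// ltW.
Qed.

(** The induction over jumps is anchored at the first grid point at or after [Tn z m], where the
    sampled path has just registered the m-th jump. *)
Let start_cv m := forall eps, 0 < eps -> exists2 eta, 0 < eta & forall h i, 0 < h < eta ->
  Tn z m <= grid 0 h i < Tn z m + h ->
  forall e, `|dfilter h (grid_path z h i) e - alp m e| <= eps.

Let interval_cv m (u : R) : jt z m = (Tn z m)%:E -> (u%:E <= jt z m.+1)%E -> Tn z m < u ->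
  start_cv m -> forall eps, 0 < eps -> exists2 eta, 0 < eta & forall h i, 0 < h < eta ->
  grid 0 h i < u <= grid 0 h i.+1 ->
  forall e, `|dfilter h (grid_path z h i) e - w m e u| <= eps.
Proof.
move=> jm um ru scv eps eps0.
have r0 : 0 <= Tn z m by rewrite -lee_fin -jm; exact: jt_ge0.
have [K K0 hK] := filter_step jm um ru.
set r := Tn z m in jm ru r0 *.
set n : R := #|{: St d}|%:R.
have n0 : 0 <= n by exact: ler0n.
have u0 : 0 < u by exact: le_lt_trans ru.
(* [n * 2] is the initial error (convergence at the start and drift of [w] up to the grid point, for
   each state), [u] bounds the accumulated local errors, the exponential is the Gronwall factor, and
   the last 1 pays for moving from the last grid point to [u]. *)
have [eps' /andP[eps'0 _] heps] : exists2 e, 0 < e <= 1 & (expR (K * u) * (n * 2 + u) + 1) * e <= eps.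
  by apply: small_factor => //; rewrite addr_ge0// mulr_ge0 ?expR_ge0// addr_ge0 ?mulr_ge0// ltW.
have [e1 e10 h1] := hK _ eps'0.
have [e2 e20 h2] := scv _ eps'0.
have [e3 e30 h3] := fin_uniform_continuity 0 u (fun e => @w_cont m e) eps'0.
exists (Num.min (Num.min e1 e2) (Num.min e3 (u - r))).
  by rewrite !lt_min e10 e20 e30 subr_gt0.
move=> h i /andP[h0]; rewrite !lt_min => /andP[/andP[he1 he2] /andP[he3 he4]] /andP[iu ui] e.
have [a /andP[ra ar]] := grid_ceil h0 r0.
have ai : (a <= i)%N.
  rewrite leqNgt; apply/negP => ia; have := le_trans ui (grid_le 0 (ltW h0) ia).
  by apply/negP; rewrite -ltNge; apply: (lt_le_trans ar); lra.
pose D l := \sum_e `|dfilter h (grid_path z h (a + l)) e - w m e (grid 0 h (a + l))|.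
have D0 : 0 <= D 0%N by apply: sumr_ge0.
have Da : D 0%N <= n * 2 * eps'.
  rewrite /D /n -sum1_card natr_sum !mulr_suml; apply: ler_sum => e' _; rewrite mul1r addn0.
  rewrite (le_trans (ler_distD (alp m e') _ _))//.
  rewrite mulr_natl mulr2n lerD//; first by apply: h2; rewrite ?h0// ra ar.
  rewrite -w0 distrC; apply: h3; rewrite ?r0 ?(ltW ru)// ger0_norm ?subr_ge0//.
  by rewrite -/r; lra.
have gl l : grid 0 h (a + l) = grid 0 h a + l%:R * h by rewrite /grid natrD mulrDl addrA.
have hD l : (l < i - a)%N -> D l.+1 <= (1 + K * h) * D l + eps' * h.
  move=> li; rewrite /D addnS; apply: h1; first by rewrite h0.
    by rewrite (le_trans ra)// grid_le ?leq_addr// ltW.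
  by apply: le_lt_trans iu; rewrite grid_le// ?ltW// -addnS -(subnKC ai) leq_add2l.
have {hD} := discrete_gronwall K0 (ltW h0) (ltW eps'0) D0 hD.
rewrite {1}/D (subnKC ai) => hDi.
have ga0 : 0 <= grid 0 h a by exact: le_trans ra.
have lu : (i - a)%:R * h <= u.
  by apply: le_trans (ltW iu); rewrite -[in leRHS](subnKC ai) gl lerDr.
have l0 : 0 <= (i - a)%:R * h by rewrite mulr_ge0// ltW.
have De : `|dfilter h (grid_path z h i) e - w m e (grid 0 h i)| <= (expR (K * u) * (n * 2 + u)) * eps'.
  apply: (@le_trans _ _ (\sum_e `|dfilter h (grid_path z h i) e - w m e (grid 0 h i)|)).
    by rewrite (bigD1 e)//= lerDl sumr_ge0.
  apply: (le_trans hDi); rewrite mulrC -mulrA ler_pM ?expR_ge0//.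
  - by rewrite addr_ge0// mulr_ge0// ltW.
  - by rewrite ler_expR ler_wpM2l.
  - by rewrite mulrDl lerD// mulrC ler_wpM2r// ltW.
rewrite (le_trans (ler_distD (w m e (grid 0 h i)) _ _))//.
apply: le_trans heps; rewrite mulrDl mul1r lerD//.
rewrite distrC; apply: h3; first by rewrite (ltW iu) (le_trans ga0)// grid_le// ltW.
by rewrite gridS in ui; rewrite ger0_norm ?subr_ge0 ?(ltW iu)//; lra.
Qed.

(** The cell containing the jump is the only one in which the scheme divides by [h]: this turns an
    off-diagonal transition probability into the intensity at the jump time, as in the recursion for
    [alpha]. *)
Let start_cvS m (u : R) : jt z m = (Tn z m)%:E -> jt z m.+1 = u%:E ->
  start_cv m -> start_cv m.+1.
Proof.
move=> jm jm1 scv.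
have r0 : 0 <= Tn z m by rewrite -lee_fin -jm; exact: jt_ge0.
have TnS : Tn z m.+1 = u by rewrite /Tn jm1.
have um : (u%:E <= jt z m.+1)%E by rewrite jm1.
have [] := jt_next zstep jm r0; rewrite jm1 lte_fin => ru zr /(_ _ erefl) zu.
have icv := interval_cv jm um ru scv.
have u0 : 0 < u by exact: le_lt_trans ru.
have [W W0 hW] := @fin_bounded _ _ (w m) 0 u (fun e => @w_cont m e).
have [B B0 hB] := @fin_bounded R (St d * St d)%type (fun p x => M x p.1 p.2) 0 u (fun p => @Mcont p.1 p.2).
set n : R := #|{: St d}|%:R.
have n0 : 0 <= n by exact: ler0n.
move=> eps eps0.
have [eps' /andP[eps'0 eps'1] heps] : exists2 e, 0 < e <= 1 & n * (2 * W + 2 + B) * e <= eps.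
  by apply: small_factor => //; rewrite mulr_ge0// !addr_ge0 ?mulr_ge0// ltW.
have [e1 e10 h1] := icv _ eps'0.
have [e2 e20 h2] := prodint_first_order Mcont hPtr (u + 1) eps'0.
have [e3 e30 h3] := @fin_uniform_continuity R (St d * St d)%type (fun p x => M x p.1 p.2) 0 u _
  (fun p => @Mcont p.1 p.2) eps'0.
have [e4 e40 h4] := zstep.1 u (ltW u0).
exists (Num.min (Num.min (Num.min e1 e2) (Num.min e3 e4)) (Num.min (u - Tn z m) 1)).
  by rewrite !lt_min e10 e20 e30 e40 subr_gt0 ru ltr01.
move=> h i /andP[h0]; rewrite !lt_min TnS.
move=> /andP[/andP[/andP[he1 he2] /andP[he3 he4]] /andP[he5 he6]] /andP[ui iu] e'.
case: i ui iu => [|i]; first by rewrite grid0 leNgt u0.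
rewrite gridS ltrD2r => ui iu.
have tu : grid 0 h i < u <= grid 0 h i.+1 by rewrite iu gridS.
have t0 : 0 <= grid 0 h i by rewrite /grid add0r mulr_ge0// ltW.
have zi : z (grid 0 h i) = Yn z m by apply: zr; [lra|rewrite lte_fin].
have zi1 : z (grid 0 h i.+1) = z u by apply: h4; rewrite gridS ui/=; lra.
have YS : Yn z m.+1 = z u by rewrite /Yn TnS.
rewrite dfilterS zi zi1 /alp YS; case: ifPn => te'; last by rewrite subrr normr0 ltW.
rewrite /jump_scale ifN; last by rewrite eq_sym.
have -> : alpha M pi0 PI z m.+1 e' = \sum_e w m e u * M u e e'.
  change (rowmul (rowmul (alpha M pi0 PI z m) (PI (Yn z m) (Tn z m) (Tn z m.+1)))
         (blockM M (Yn z m) (Yn z m.+1) (Tn z m.+1)) e' = \sum_e w m e u * M u e e').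
  rewrite TnS {1}/rowmul; apply: eq_bigr => e _; rewrite /blockM YS te' andbT /w.
  by case: ifP => _; rewrite ?mulr0 ?mul0r.
rewrite mulr_suml -sumrB; apply: (le_trans (ler_norm_sum _ _ _)); apply: le_trans heps.
rewrite /n -sum1_card natr_sum !mulr_suml; apply: ler_sum => e _; rewrite mul1r.
set V := dfilter h _ _.
have [te|te] := eqVneq (tag e) (Yn z m); last first.
  rewrite (w_supp _ te) /V; have [q ->] := grid_pathE z h i.
  rewrite zi dfilter_supp// !mul0r subrr normr0.
  by rewrite mulr_ge0 ?addr_ge0 ?mulr_ge0 ?ltW.
have ee' : e != e'.
  by apply: contraNneq zu => ee'; rewrite -(eqP te') -ee' te.
set p := Ptr _ _ _ _.
(* The macrostates differ, so the identity drops out of the expansion of [Ptr]. One [eps'] is the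
   expansion error divided by [h], the other the variation of [M] between the grid point and [u]. *)
have hp : `|p / h - M u e e'| <= 2 * eps'.
  rewrite (le_trans (ler_distD (M (grid 0 h i) e e') _ _))// mulr_natl mulr2n lerD//.
    have := h2 (grid 0 h i) (grid 0 h i.+1) e e' t0.
    rewrite gridS (_ : _ + h - _ = h); last by lra.
    rewrite (negPf ee') subr0 -gridS -/p => h2'.
    have {}h2' : `|p - h * M (grid 0 h i) e e'| <= eps' * h.
      by apply: h2' => //; rewrite gridS; lra.
    rewrite -(@ler_pM2r _ h)// -[X in _ * X <= _](gtr0_norm h0) -normrM mulrBl divfK ?gt_eqF//.
    by rewrite [M _ _ _ * _]mulrC.
  rewrite distrC; apply: (h3 (e, e')); first by rewrite t0 ltW.
  by rewrite ger0_norm ?subr_ge0 ?(ltW iu)//; lra.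
have hV : `|V - w m e u| <= eps' by apply: h1; rewrite // h0 he1.
have hw : `|w m e u| <= W by apply: hW; rewrite lexx ltW.
have hM : `|M u e e'| <= B by apply: (hB (e, e')); rewrite lexx ltW.
have hV' : `|V| <= W + 1.
  by rewrite -[V](subrK (w m e u)) addrC (le_trans (ler_normD _ _))// lerD// (le_trans hV).
have -> : V * p / h - w m e u * M u e e' = V * (p / h - M u e e') + (V - w m e u) * M u e e'.
  by rewrite mulrBr mulrBl mulrA addrA subrK.
apply: (le_trans (ler_normD _ _)); rewrite !normrM.
apply: (@le_trans _ _ ((W + 1) * (2 * eps') + eps' * B)); first by rewrite lerD// ler_pM.
by rewrite le_eqVlt; apply/orP; left; apply/eqP; lra.
Qed.

Let start_cv_all m : jt z m = (Tn z m)%:E -> start_cv m.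
Proof.
elim: m => [|m IH] jm.
  move=> eps eps0; exists 1 => // h i /andP[h0 _]; rewrite /Tn /= add0r => /andP[_ ih] e.
  have -> : i = 0%N.
    by case: i ih => // i; rewrite /grid add0r -natr1 mulrDl mul1r gtrDr ltNge mulr_ge0// ltW.
  by rewrite /alp /Yn /Tn /= subrr normr0 ltW.
have jm' : jt z m = (Tn z m)%:E.
  move: jm; rewrite [jt z m.+1]/= /Tn; case: (jt z m) => //.
exact: start_cvS jm' jm (IH jm').
Qed.

Lemma dfilter_cvg (u eps : R) : 0 < u -> 0 < eps -> exists2 eta, 0 < eta & forall h i, 0 < h < eta ->
  grid 0 h i < u <= grid 0 h i.+1 ->
  forall e, `|dfilter h (grid_path z h i) e - filter_num z u e| <= eps.
Proof.
move=> u0 eps0; rewrite /filter_num.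
case: xgetP => [n _ [nu un]|/(_ _)]; last first.
  by have [n hn] := jt_exists zstep u0 => /(_ n).
have jn : jt z n = (Tn z n)%:E.
  by rewrite /Tn fineK// ge0_fin_numE ?jt_ge0// (lt_trans nu) ?ltry.
apply: interval_cv => //; first by rewrite -lte_fin -jn.
exact: start_cv_all.
Qed.

End fixed_path.
End discrete_filter.

(** * Joint measurability of the intensity *)

(** By the cut-off in [filter_num], summing over all states is summing over the current macrostate,
    so the index of the interval disappears; when that macrostate is not [j], the numerator vanishes
    and gives the required 0. *)
Lemma lamE (R : realType) (J : nat) (d : 'I_J.+1 -> nat) (M : R -> St d -> St d -> R)
  (PI : 'I_J.+1 -> R -> R -> St d -> St d -> R) (pi0 : St d -> R)
  (z : R -> 'I_J.+1) (j k : 'I_J.+1) (u : R) : step_path z -> 0 < u ->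
  lam M pi0 PI z j k u =
  (\sum_(e | tag e == j) \sum_(e' | tag e' == k) filter_num M PI pi0 z u e * M u e e') /
  (\sum_e filter_num M PI pi0 z u e).
Proof.
move=> zstep u0; rewrite /lam; case: pselect => [_|]; last by case; exact: jt_exists.
rewrite /lam_term /filter_num; set n := xget _ _.
case: ifP => [/eqP <-|yj].
  congr (_ / _); first by apply: eq_bigr => e te; apply: eq_bigr => e' _; rewrite te.
  by rewrite [LHS]big_mkcond.
rewrite big1 ?mul0r// => e /eqP te; rewrite te eq_sym yj big1// => e' _.
by rewrite mul0r.
Qed.

Lemma grid_cell (R : realType) (h u : R) (n : nat) : 0 < h -> 0 < u -> u <= n%:R * h ->
  exists i : 'I_n, grid 0 h i < u <= grid 0 h i.+1.
Proof.
move=> h0 u0 un.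
have H : exists m, u <= grid 0 h m by exists n; rewrite /grid add0r.
case: (ex_minnP H) => -[|m]; first by rewrite grid0 leNgt u0.
move=> um hmin; have mn : (m < n)%N by apply: hmin; rewrite /grid add0r.
exists (Ordinal mn); rewrite /= um andbT ltNge; apply/negP => /hmin; by rewrite ltnn.
Qed.

Lemma grid_cell_uniq (R : realType) (h u : R) (i i' : nat) : 0 < h ->
  grid 0 h i < u <= grid 0 h i.+1 -> grid 0 h i' < u <= grid 0 h i'.+1 -> i = i'.
Proof.
move=> h0 /andP[iu ui] /andP[iu' ui'].
have L a b : grid 0 h a < u -> u <= grid 0 h b.+1 -> (a <= b)%N.
  move=> au ub; have := lt_le_trans au ub; rewrite /grid !add0r ltr_pM2r// ltr_nat.
  by rewrite ltnS.
by apply/eqP; rewrite eqn_leq !L.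
Qed.

Fixpoint paths (J : nat) (i : nat) : seq (seq 'I_J.+1) :=
  match i with
  | O => [seq [:: y] | y <- index_enum 'I_J.+1]
  | i'.+1 => [seq y :: q | q <- paths J i', y <- index_enum 'I_J.+1]
  end.

Lemma sum_paths0 (R : realType) (J : nat) (F : seq 'I_J.+1 -> R) :
  \sum_(q <- paths J 0) F q = \sum_y F [:: y].
Proof. by rewrite big_map. Qed.

Lemma sum_pathsS (R : realType) (J i : nat) (F : seq 'I_J.+1 -> R) :
  \sum_(q <- paths J i.+1) F q = \sum_(q <- paths J i) \sum_y F (y :: q).
Proof. by rewrite big_allpairs_dep. Qed.

Lemma grid_path_decomp (R : realType) (J : nat) (F : seq 'I_J.+1 -> R) (z : R -> 'I_J.+1) (h : R) i :
  F (grid_path z h i) = \sum_(q <- paths J i) F q * (grid_path z h i == q)%:R.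
Proof.
elim: i F => [|i IH] F.
  rewrite sum_paths0 /= (bigD1 (z 0))//= eqxx mulr1 big1 ?addr0// => y yz.
  by rewrite (_ : ([:: z 0] == [:: y]) = false) ?mulr0// eqseq_cons eq_sym (negPf yz).
rewrite sum_pathsS /= (IH (fun q => F (z (grid 0 h i.+1) :: q))).
apply: eq_bigr => q _; rewrite (bigD1 (z (grid 0 h i.+1)))//= eqseq_cons eqxx/= big1 ?addr0//.
by move=> y yz; rewrite eqseq_cons eq_sym (negPf yz) mulr0.
Qed.

Lemma measurable_invr (R : realType) : measurable_fun setT (fun x : R => x^-1).
Proof.
rewrite -(setUv [set 0 : R]); apply/measurable_funU => //; first exact: measurableC.
split; first exact: measurable_fun_set1.
apply: open_continuous_measurable_fun.
  by rewrite openC; apply: accessible_closed_set1; apply: hausdorff_accessible; exact: Rhausdorff.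
by move=> x; rewrite inE => /eqP x0; exact: inv_continuous.
Qed.

Section grid_path_measurability.
Variables (R : realType) (J : nat).
Variables (dT : measure_display) (T : measurableType dT) (Z : R -> T -> 'I_J.+1) (c : R).
Hypothesis (c0 : 0 <= c).
Hypothesis (Zmeas : forall r y, 0 <= r <= c -> measurable [set w | Z r w = y]).

(** The measurable space is abstract in order to be either [Omega] or a sigma-algebra of a natural
    filtration; the latter choice yields adaptedness. *)
Lemma measurable_grid_path h i q : 0 < h -> i%:R * h <= c ->
  measurable [set w | grid_path (fun r => Z r w) h i = q].
Proof.
move=> h00; elim: i q => [|i IH] [|y q] ic.
- by rewrite (_ : [set w | _] = set0)// -subset0 => w.
- case: q => [|y' q]; last by rewrite (_ : [set w | _] = set0)// -subset0 => w.
  rewrite (_ : [set w | _] = [set w | Z 0 w = y]); first by apply: Zmeas; rewrite lexx c0.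
  by apply/seteqP; split => w /= [->].
- by rewrite (_ : [set w | _] = set0)// -subset0 => w.
- rewrite (_ : [set w | _] = [set w | Z (grid 0 h i.+1) w = y] `&`
     [set w | grid_path (fun r => Z r w) h i = q]); last first.
    by apply/seteqP; split => w /=; [case=> -> ->|case=> -> ->].
  apply: measurableI.
    by apply: Zmeas; rewrite /grid add0r ic mulr_ge0// ltW.
  by apply: IH; apply: le_trans ic; rewrite ler_wpM2r ?ler_nat// ltW.
Qed.

Lemma measurable_fun_grid_path (F : seq 'I_J.+1 -> R) h i : 0 < h -> i%:R * h <= c ->
  measurable_fun setT (fun w => F (grid_path (fun r => Z r w) h i)).
Proof.
move=> h00 ic.
rewrite (_ : (fun w => _) = (fun w => \sum_(q <- paths J i) F q *
    \1_[set w | grid_path (fun r => Z r w) h i = q] w)); last first.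
  apply/funext => w; rewrite [LHS](grid_path_decomp F); apply: eq_bigr => q _; congr (_ * _).
  by rewrite indicE; congr ((_ : bool)%:R); apply/eqP/idP; rewrite inE.
apply: measurable_sum => q; apply: measurable_funM => //.
by apply: measurable_indic; exact: measurable_grid_path.
Qed.

End grid_path_measurability.

Section joint_measurability.
Variables (R : realType) (J : nat) (d : 'I_J.+1 -> nat).
Variables (M : R -> St d -> St d -> R) (Ptr : R -> R -> St d -> St d -> R).
Variables (PI : 'I_J.+1 -> R -> R -> St d -> St d -> R) (pi0 : St d -> R).
Hypotheses (Mcont : forall e e', continuous (fun x => M x e e'))
  (hPtr : is_prodint M Ptr) (hPI : forall j, is_prodint (blockM M j j) (PI j)).
Variables (dT : measure_display) (T : measurableType dT) (Z : R -> T -> 'I_J.+1) (c : R).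
Hypotheses (c0 : 0 < c) (Zstep : forall w, step_path (fun r => Z r w)).
Hypothesis (Zmeas : forall r y, 0 <= r <= c -> measurable [set w | Z r w = y]).

Let hn n := c / 2 ^+ n.
Let h0 n : 0 < hn n. Proof. by rewrite divr_gt0// exprn_gt0. Qed.
Let hE n : (2 ^ n)%:R * hn n = c.
Proof. by rewrite /hn natrX mulrC divfK// expf_neq0// pnatr_eq0. Qed.

Definition grid_filter n (p : T * R) (e : St d) : R :=
  \sum_(i < 2 ^ n) \1_(`]grid 0 (hn n) i, grid 0 (hn n) i.+1]%classic : set R) p.2 *
     dfilter Ptr pi0 (hn n) (grid_path (fun r => Z r p.1) (hn n) i) e.

Lemma grid_filterE n w u e (i : 'I_(2 ^ n)) : grid 0 (hn n) i < u <= grid 0 (hn n) i.+1 ->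
  grid_filter n (w, u) e = dfilter Ptr pi0 (hn n) (grid_path (fun r => Z r w) (hn n) i) e.
Proof.
move=> iu; rewrite /grid_filter (bigD1 i)//= indicE mem_set ?mul1r/= ?in_itv//.
rewrite big1 ?addr0// => i' ii'; rewrite indicE memNset ?mul0r//= in_itv/= => iu'.
by move: ii'; rewrite -val_eqE/= (grid_cell_uniq (h0 n) iu iu') eqxx.
Qed.

Lemma measurable_grid_filter n e : measurable_fun setT (fun p => grid_filter n p e).
Proof.
apply: measurable_sum => i; apply: measurable_funM.
  by apply: measurableT_comp => //; apply: measurable_indic.
apply: (@measurableT_comp _ _ _ _ _ _ (fun w => dfilter Ptr pi0 (hn n) (grid_path (fun r => Z r w) (hn n) i) e)) => //.
apply: (measurable_fun_grid_path (ltW c0) Zmeas (fun q => dfilter Ptr pi0 (hn n) q e)) => //.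
by rewrite -(hE n) ler_wpM2r ?ler_nat ?(ltnW (ltn_ord i))// ltW.
Qed.

Lemma grid_filter_cvg w u e : 0 < u <= c ->
  grid_filter n (w, u) e @[n --> \oo] --> filter_num M PI pi0 (fun r => Z r w) u e.
Proof.
move=> /andP[u0 uc]; apply/cvgrPdist_le => eps eps0.
have [eta eta0 heta] := dfilter_cvg pi0 Mcont hPtr hPI (Zstep w) u0 eps0.
have /cvgrPdist_lt/(_ _ eta0) := pow2_cvg0 c.
apply: filterS => n; rewrite sub0r normrN gtr0_norm ?h0// => hlt.
have [|i iu] := @grid_cell R (hn n) u (2 ^ n) (h0 n) u0; first by rewrite hE.
by rewrite (grid_filterE _ _ iu) distrC; apply: heta => //; rewrite h0.
Qed.

(** A pointwise limit of functionals of sampled paths. The cut-off at [c] keeps every sampled time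
    in the range where [Z] is assumed measurable, as needed when the sigma-algebra is that of F^Z at
    time [c]. *)
Lemma measurable_filter_num e : measurable_fun setT (fun p : T * R =>
  if 0 < p.2 <= c then filter_num M PI pi0 (fun r => Z r p.1) p.2 e else 0).
Proof.
apply: (@measurable_fun_cvg _ _ _ _ (fun n p => grid_filter n p e)).
  by move=> n; exact: measurable_grid_filter.
move=> [w u] _ /=; case: ifPn => uc; first exact: grid_filter_cvg.
apply: cvg_near_cst; apply: nearW => n; rewrite /grid_filter big1// => i _.
rewrite indicE memNset ?mul0r//= in_itv/= => /andP[iu ui]; move: uc => /negP; apply.
apply/andP; split; first by apply: le_lt_trans iu; rewrite /grid add0r mulr_ge0// ltW.
by apply: (le_trans ui); rewrite -(hE n) /grid add0r ler_wpM2r ?ler_nat// ltW.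
Qed.

Lemma measurable_lam j k : measurable_fun setT (fun p : T * R =>
  if 0 < p.2 <= c then lam M pi0 PI (fun r => Z r p.1) j k p.2 else 0).
Proof.
pose G e (p : T * R) := if 0 < p.2 <= c then filter_num M PI pi0 (fun r => Z r p.1) p.2 e else 0.
rewrite (_ : (fun p => _) = fun p : T * R => (\sum_(e <- index_enum (St d)) \sum_(e' <- index_enum (St d))
   if (tag e == j) && (tag e' == k) then G e p * M p.2 e e' else 0) * (\sum_(e <- index_enum (St d)) G e p)^-1); last first.
  apply/funext => -[w u] /=; rewrite /G /=; case: ifPn => [/andP[u0 _]|_]; last first.
    by rewrite [X in X^-1]big1 ?invr0 ?mulr0.
  rewrite lamE//; congr (_ / _); rewrite big_mkcond/=; apply: eq_bigr => e _.
  case: ifP => _; last by rewrite big1.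
  by rewrite big_mkcond.
apply: measurable_funM.
  apply: measurable_sum => e; apply: measurable_sum => e'; case: ((tag e == j) && _) => //.
  apply: measurable_funM; first exact: measurable_filter_num.
  apply: (@measurableT_comp _ _ _ _ _ _ (fun x => M x e e')) => //.
  exact: continuous_measurable_fun.
apply: (@measurableT_comp _ _ _ _ _ _ (fun x : R => x^-1)); first exact: measurable_invr.
by apply: measurable_sum => e; exact: measurable_filter_num.
Qed.

End joint_measurability.

(** * Expectations and natural filtrations *)

Lemma normr_indic_le1 (R : realType) (T : Type) (A : set T) (x : T) : `|\1_A x : R| <= 1.
Proof. by rewrite indicE; case: (_ \in _); rewrite ?normr1 ?normr0. Qed.

Lemma integrable_rsum (R : realType) (dm : measure_display) (Omega : measurableType dm)
    (P : {measure set Omega -> \bar R}) (I : Type) (s : seq I) (f : I -> Omega -> R) :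
  (forall i, P.-integrable setT (EFin \o f i)) ->
  P.-integrable setT (EFin \o (fun w => \sum_(i <- s) f i w)).
Proof.
move=> hf; rewrite (_ : _ \o _ = fun w => (\sum_(i <- s) (EFin \o f i) w)%E).
  exact: integrable_sum.
by apply/funext => w /=; rewrite sumEFin.
Qed.

Section expectation.
Variables (R : realType) (dm : measure_display) (Omega : measurableType dm).
Variable (P : probability Omega R).

Lemma bounded_integrable (f : Omega -> R) (K : R) : measurable_fun setT f ->
  (forall w, `|f w| <= K) -> P.-integrable setT (EFin \o f).
Proof.
move=> mf fK; apply: measurable_bounded_integrable => //.
  by apply: (le_lt_trans (probability_le1 P measurableT)); rewrite ltry.
exists K; split; first exact: num_real.
by move=> x Kx w _ /=; rewrite (le_trans (fK w))// ltW.
Qed.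

Lemma Rintegral_cvg_bounded (f_ : nat -> Omega -> R) (f : Omega -> R) (K : R) :
  (forall n, measurable_fun setT (f_ n)) -> (forall n w, `|f_ n w| <= K) ->
  (forall w, f_ n w @[n --> \oo] --> f w) ->
  \int[P]_w f_ n w @[n --> \oo] --> \int[P]_w f w.
Proof.
move=> mf fK ff; have mf' : measurable_fun setT f.
  exact: (@measurable_fun_cvg _ _ _ _ f_).
have iK : P.-integrable setT (cst K%:E : Omega -> \bar R).
  by apply: (@bounded_integrable (cst K) `|K|).
have [||||fi _ h] := @dominated_convergence _ _ _ P setT measurableT (fun n w => (f_ n w)%:E)
  (EFin \o f) (cst K%:E) _ _ _ iK _.
- by move=> n; apply/measurable_EFinP.
- exact/measurable_EFinP.
- by apply: aeW => w _; apply: cvg_EFin; [exact: nearW|exact: ff].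
- by apply: aeW => w n _; rewrite /= lee_fin.
rewrite /Rintegral; apply: fine_cvg; rewrite fineK//.
exact: integrable_fin_num.
Qed.

Lemma Rintegral_indic_pr (A : set Omega) : measurable A -> \int[P]_w \1_A w = fine (P A).
Proof. by move=> mA; rewrite /Rintegral integral_indic// setIT. Qed.

Lemma Rintegral_sum_seq (I : Type) (s : seq I) (f : I -> Omega -> R) :
  (forall i, P.-integrable setT (EFin \o f i)) ->
  \int[P]_w (\sum_(i <- s) f i w) = \sum_(i <- s) \int[P]_w f i w.
Proof.
move=> hf; elim: s => [|i s IH].
  by rewrite big_nil; under eq_Rintegral do rewrite big_nil; rewrite Rintegral_cst// mul0r.
under eq_Rintegral do rewrite big_cons.
rewrite big_cons RintegralD//; first by rewrite IH.
exact: integrable_rsum.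
Qed.

End expectation.

(** * Total mass of the grid paths weighted by powers of the mesh *)

Section path_weights.
Variables (R : realType) (J : nat).

Fixpoint path_weight (h : R) (q : seq 'I_J.+1) : R :=
  match q with
  | [::] => 1
  | y :: q' => match q' with
    | [::] => 1
    | y' :: _ => path_weight h q' * (if y' == y then 1 else h)
    end
  end.

Lemma path_weight_gt0 h q : 0 < h -> 0 < path_weight h q.
Proof.
by move=> h0; elim: q => // y [|y' q] //= IH; rewrite mulr_gt0//; case: ifP.
Qed.

Lemma size_paths i q : q \in paths J i -> size q = i.+1.
Proof.
elim: i q => [|i IH] q; first by move=> /mapP[y _ ->].
by move=> /allpairsPdep[q' [y [/IH sq _ ->]]] /=; rewrite sq.
Qed.

(** A path is extended by staying, with weight 1, or by moving to another state, with weight [h]: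
    each step costs a factor at most [1 + J.+1 * h], which is below an exponential. *)
Lemma sum_path_weight h i : 0 <= h ->
  \sum_(q <- paths J i) path_weight h q <= J.+1%:R * expR (J.+1%:R * (i%:R * h)).
Proof.
move=> h0; elim: i => [|i IH].
  by rewrite sum_paths0/= sumr_const card_ord mul0r mulr0 expR0 mulr1.
rewrite sum_pathsS; apply: (@le_trans _ _ (\sum_(q <- paths J i) path_weight h q * (1 + J.+1%:R * h))).
  rewrite big_seq [leRHS]big_seq; apply: ler_sum => q /size_paths; case: q => // y' q _.
  rewrite /= -mulr_sumr ler_wpM2l//.
    elim: q y' => //= y q IHq y'; rewrite mulr_ge0//; by case: ifP.
  rewrite (bigD1 y')//= eqxx lerD2l.
  apply: (@le_trans _ _ (\sum_(y < J.+1) h)); last by rewrite sumr_const card_ord mulr_natl.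
  rewrite big_mkcond; apply: ler_sum => y _; case: ifP => // yy.
  by rewrite eq_sym (negPf yy).
have -> : J.+1%:R * (i.+1%:R * h) = J.+1%:R * (i%:R * h) + J.+1%:R * h :> R.
  by rewrite -[in i.+1%:R]natr1 mulrDl mul1r mulrDr.
rewrite -mulr_suml expRD mulrA ler_pM//.
- by apply: sumr_ge0 => q _; elim: q => // y [|y' q] //= IHq; rewrite mulr_ge0//; case: ifP.
- by rewrite addr_ge0// mulr_ge0.
- exact: expR_ge1Dx.
Qed.
End path_weights.

(** The envelope varies with n. Being increasing with bounded integrals, it has an integrable limit
    by monotone convergence, and that limit dominates the whole sequence. *)
Lemma Rintegral_cvg_monotone_dominated (R : realType) (dm : measure_display)
    (Omega : measurableType dm) (P : {measure set Omega -> \bar R})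
    (f_ K : nat -> Omega -> R) (f : Omega -> R) (B : R) :
  (forall n, measurable_fun setT (f_ n)) -> (forall n, measurable_fun setT (K n)) ->
  (forall n w, `|f_ n w| <= K n w) -> (forall n w, K n w <= K n.+1 w) ->
  (forall n, (\int[P]_w (K n w)%:E <= B%:E)%E) ->
  (forall w, f_ n w @[n --> \oo] --> f w) ->
  P.-integrable setT (EFin \o f) /\
  \int[P]_w f_ n w @[n --> \oo] --> \int[P]_w f w.
Proof.
move=> mf mK fK KS KB ff.
have mf' : measurable_fun setT f by exact: (@measurable_fun_cvg _ _ _ _ f_).
have K0 n w : 0 <= K n w by exact: le_trans (fK n w).
have ndK w : nondecreasing_seq (fun n => (K n w)%:E).
  by apply/nondecreasing_seqP => n; rewrite lee_fin.
pose g w := limn (fun n => (K n w)%:E).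
have mKE n : measurable_fun setT (fun w => (K n w)%:E) by apply/measurable_EFinP.
have cK w : (K n w)%:E @[n --> \oo] --> g w by exact: ereal_nondecreasing_is_cvgn.
have mg : measurable_fun setT g.
  by apply: (@emeasurable_fun_cvg _ _ _ _ (fun n w => (K n w)%:E)) => // w _; exact: cK.
have Kg n w : ((K n w)%:E <= g w)%E.
  apply: (cvge_to_ge (cK w)); exists n => // m /= nm; exact: ndK.
have g0 w : (0 <= g w)%E by apply: le_trans (Kg 0%N w); rewrite lee_fin.
have ig : P.-integrable setT g.
  apply/integrableP; split => //.
  under eq_integral do rewrite gee0_abs//.
  apply: (@le_lt_trans _ _ B%:E); last exact: ltry.
  have h := @cvg_monotone_convergence _ _ _ P setT measurableT (fun n w => (K n w)%:E) mKE
    (fun n w _ => K0 n w) (fun w _ => ndK w).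
  by apply: (cvge_to_le h); apply: nearW.
have [||||fi _ h] := @dominated_convergence _ _ _ P setT measurableT (fun n w => (f_ n w)%:E)
  (EFin \o f) g _ _ _ ig _.
- by move=> n; apply/measurable_EFinP.
- exact/measurable_EFinP.
- by apply: aeW => w _; apply: cvg_EFin; [exact: nearW|exact: ff].
- by apply: aeW => w n _; apply: le_trans (Kg n w); rewrite /= lee_fin.
split => //; rewrite /Rintegral; apply: fine_cvg; rewrite fineK//.
exact: integrable_fin_num.
Qed.

(** A change over a double step forces a change in at least one of its halves. *)
Lemma refine_count_le (R : realType) (T : eqType) (x : nat -> T) (n : nat) :
  \sum_(a < n) (x a.*2 != x a.+1.*2)%:R <= \sum_(a < n.*2) (x a != x a.+1)%:R :> R.
Proof.
elim: n => [|n IH]; first by rewrite !big_ord0.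
rewrite big_ord_recr doubleS !big_ord_recr/= -addrA lerD//.
have [E|] := eqVneq (x n.*2) (x n.*2.+1); last by case: (_ != _); case: (_ != _); rewrite /= ?lexx ?lerDl ?lerDr ?addr_ge0 ?ler01.
by rewrite E add0r.
Qed.

Section natural_filtration.
Variables (R : realType) (Omega : pointedType).

Lemma natfilt_mono (T : Type) (W : R -> Omega -> T) (s t : R) :
  s <= t -> natfilt W s `<=` natfilt W t.
Proof.
move=> st; apply: sub_sigma_algebra2 => A [u [e [/andP[u0 us] ->]]]; exists u, e; split => //.
by rewrite u0 (le_trans us).
Qed.

Lemma natfilt_gen (T : Type) (W : R -> Omega -> T) (s r : R) (e : T) :
  0 <= r <= s -> natfilt W s [set w | W r w = e].
Proof. by move=> rs; apply: sub_gen_smallest; exists r, e. Qed.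

(** The generator occurring in [natfilt], named so that membership in the filtration is, by
    conversion, measurability in a measurable type. *)
Definition natgen (T : Type) (W : R -> Omega -> T) (s : R) : set (set Omega) :=
  [set A | exists u e, (0 <= u <= s)%R /\ A = [set w | W u w = e]].

Lemma natfiltE (T : Type) (W : R -> Omega -> T) (s : R) (A : set Omega) :
  natfilt W s A = measurable (A : set (g_sigma_algebraType (natgen W s))).
Proof. by []. Qed.

Lemma natfilt_setT (T : Type) (W : R -> Omega -> T) (s : R) :
  natfilt W s setT.
Proof. by rewrite natfiltE. Qed.

Lemma natfiltI (T : Type) (W : R -> Omega -> T) (s : R) A B :
  natfilt W s A -> natfilt W s B -> natfilt W s (A `&` B).
Proof. by rewrite !natfiltE; exact: measurableI. Qed.

Lemma natfilt_comp (T : finType) (U : eqType) (f : T -> U) (W : R -> Omega -> T) (s r : R) (y : U) :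
  0 <= r <= s -> natfilt W s [set w | f (W r w) = y].
Proof.
move=> rs; rewrite (_ : [set w | _] = \bigcup_(e in [set e | f e = y]) [set w | W r w = e]).
  rewrite natfiltE; apply: fin_bigcup_measurable; first exact: finite_finset.
  by move=> e _; exact: natfilt_gen.
by apply/seteqP; split => w /= => [<-|[e <- ->]//]; exists (W r w).
Qed.

Lemma natfilt_comp_sub (T : finType) (U : eqType) (f : T -> U) (W : R -> Omega -> T) (s : R) :
  natfilt (fun r w => f (W r w)) s `<=` natfilt W s.
Proof.
apply: smallest_sub; first exact: smallest_sigma_algebra.
by move=> A [u [e [us ->]]]; exact: natfilt_comp.
Qed.
End natural_filtration.

Lemma natfilt_measurable (R : realType) (dm : measure_display) (Omega : measurableType dm)
  (T : Type) (W : R -> Omega -> T) (s : R) :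
  (forall t e, 0 <= t -> measurable [set w | W t w = e]) -> natfilt W s `<=` measurable.
Proof.
move=> Wm; apply: smallest_sub; first exact: sigma_algebra_measurable.
by move=> A [u [e [/andP[u0 _] ->]]]; exact: Wm.
Qed.

Section riemann.
Variables (R : realType) (f : R -> R).
Hypothesis cf : continuous f.
Let mu := (@lebesgue_measure R).

Lemma continuous_itv_integrable (a b : R) : mu.-integrable `]a, b] (EFin \o f).
Proof.
have [ab|ba] := leP a b; last by rewrite set_itv_ge ?integrable_set0// bnd_simp -leNgt ltW.
apply: (@integrableS _ _ _ mu `[a, b]) => //.
  by apply: subset_itvr; rewrite bnd_simp.
apply: continuous_compact_integrable; first exact: segment_compact.
exact: continuous_subspaceT.
Qed.

(** Shaped like [prodint_first_order], so that the two local expansions can be compared cell by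
    cell. *)
Lemma riemann_first_order (s t eps : R) : 0 < eps ->
  exists2 eta, 0 < eta & forall x y, s <= x -> x <= y -> y <= t -> y - x < eta ->
  `|\int[mu]_(u in `]s, y]) f u - \int[mu]_(u in `]s, x]) f u - (y - x) * f x| <= eps * (y - x).
Proof.
move=> eps0; have [eta eta0 he] := uniform_continuity_itv s t cf eps0.
exists eta => // x y sx xy yt yx.
rewrite Rintegral_itvB ?bnd_simp//; last exact: continuous_itv_integrable.
have mE : fine (mu `]x, y]) = y - x.
  rewrite /mu lebesgue_measure_itv/= lte_fin; case: ifPn => //; rewrite -leNgt => yx'.
  by apply/esym/eqP; rewrite subr_eq0 eq_le xy yx'.
have ic (c : R) : mu.-integrable `]x, y] (EFin \o cst c).
  have muxy : (mu `]x, y] < +oo)%E by rewrite /mu lebesgue_measure_itv/=; case: ifP => _; rewrite ?ltry.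
  apply: (measurable_bounded_integrable _ muxy) => //.
  by exists `|c|; split; [exact: num_real|move=> z cz w _ /=; exact: ltW].
have -> : (y - x) * f x = \int[mu]_(u in `]x, y]) cst (f x) u.
  by rewrite Rintegral_cst// mE mulrC.
rewrite -RintegralB//; last exact: continuous_itv_integrable.
have ifx : mu.-integrable `]x, y] (EFin \o (fun u => f u - cst (f x) u)).
  rewrite (_ : _ \o _ = ((EFin \o f) \- (EFin \o cst (f x)))%E)//.
  by apply: integrableB => //; exact: continuous_itv_integrable.
apply: (le_trans (le_normr_Rintegral _ ifx)) => //.
have -> : eps * (y - x) = \int[mu]_(u in `]x, y]) cst eps u by rewrite Rintegral_cst// mE.
apply: le_Rintegral => //; first exact: (integrable_norm ifx).
move=> u /=; rewrite in_itv/= => /andP[xu uy]; apply: he.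
  by rewrite sx/= (le_trans xy).
by rewrite ger0_norm ?subr_ge0 ?(ltW xu)//; apply: le_lt_trans yx; rewrite lerD2r.
Qed.
End riemann.

(** * The filter formula and the compensator *)

Section pi_lambda.
Variables (R : realType) (dm : measure_display) (Omega : measurableType dm).
Variable (P : probability Omega R).

Lemma pi_lambda_Rintegral (f g : Omega -> R) (G : set (set Omega)) :
  measurable_fun setT f -> measurable_fun setT g ->
  (forall w, `|f w| <= 1) -> (forall w, `|g w| <= 1) ->
  G `<=` measurable -> setI_closed G -> G setT ->
  (forall A, G A -> \int[P]_w (\1_A w * f w) = \int[P]_w (\1_A w * g w)) ->
  forall A, <<s G >> A -> \int[P]_w (\1_A w * f w) = \int[P]_w (\1_A w * g w).
Proof.
move=> mf mg f1 g1 Gm GI GT Gfg.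
have m1 (A : set Omega) (k : Omega -> R) : measurable A -> measurable_fun setT k ->
    measurable_fun setT (fun w => \1_A w * k w).
  by move=> mA mk; apply: measurable_funM => //; exact: measurable_indic.
have b1 (A : set Omega) (k : Omega -> R) : (forall w, `|k w| <= 1) -> forall w, `|\1_A w * k w| <= 1.
  by move=> k1 w; rewrite normrM mulr_ile1// normr_indic_le1.
have i1 (A : set Omega) (k : Omega -> R) : measurable A -> measurable_fun setT k ->
    (forall w, `|k w| <= 1) -> P.-integrable setT (EFin \o (fun w => \1_A w * k w)).
  by move=> mA mk k1; apply: (@bounded_integrable _ _ _ _ _ 1); [exact: m1|exact: b1].
suff : <<s G >> `<=` [set A | measurable A /\
    \int[P]_w (\1_A w * f w) = \int[P]_w (\1_A w * g w)] by move=> h A /h[].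
apply: lambda_system_subset => //; last first.
- by move=> A GA; split; [exact: Gm|exact: Gfg].
- split => //.
  + by split => //; exact: Gfg.
  + move=> A B BA [mA EA] [mB EB]; split; first exact: measurableD.
    have E (k : Omega -> R) : measurable_fun setT k -> (forall w, `|k w| <= 1) ->
        \int[P]_w (\1_(A `\` B) w * k w) = \int[P]_w (\1_A w * k w) - \int[P]_w (\1_B w * k w).
      move=> mk k1; rewrite -RintegralB//; [|exact: i1|exact: i1].
      apply: eq_Rintegral => w _; rewrite -mulrBl; congr (_ * _).
      rewrite !indicE in_setD; have := BA w; case: (boolP (w \in B)) => wB.
        by rewrite inE in wB => /(_ wB) /mem_set ->; rewrite subrr.
      by rewrite subr0 andbT.
    by rewrite !E// EA EB.
  + move=> F ndF hF; have mF n : measurable (F n) by case: (hF n).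
    have mU : measurable (\bigcup_i F i) by exact: bigcupT_measurable.
    split => //.
    have L (k : Omega -> R) : measurable_fun setT k -> (forall w, `|k w| <= 1) ->
        \int[P]_w (\1_(F n) w * k w) @[n --> \oo] --> \int[P]_w (\1_(\bigcup_i F i) w * k w).
      move=> mk k1; apply: (@Rintegral_cvg_bounded _ _ _ _ _ _ 1).
      - by move=> n; exact: m1.
      - by move=> n; exact: b1.
      - move=> w; apply: cvgMl; apply: cvg_near_cst.
        have [[n _ Fnw]|nF] := pselect ((\bigcup_i F i) w).
          exists n => // m /= nm; rewrite !indicE !mem_set//; first by exists n.
          by have /subsetPset := ndF _ _ nm; exact.
        apply: nearW => n; rewrite !indicE !memNset// => Fnw; apply: nF; by exists n.
    rewrite -(cvg_lim (@Rhausdorff R) (L f mf f1)) -(cvg_lim (@Rhausdorff R) (L g mg g1)).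
    have -> : (fun n => \int[P]_w (\1_(F n) w * f w)) = (fun n => \int[P]_w (\1_(F n) w * g w)).
      by apply/funext => n; case: (hF n).
    by [].
Qed.
End pi_lambda.

Lemma nth_grid_path (R : realType) (J : nat) (z : R -> 'I_J.+1) (h : R) (i a : nat) :
  (a <= i)%N -> nth ord0 (grid_path z h i) (i - a) = z (grid 0 h a).
Proof.
elim: i => [|i IH].
  by rewrite leqn0 => /eqP ->; rewrite /= grid0.
rewrite leq_eqVlt => /predU1P[->|]; first by rewrite subnn.
by rewrite ltnS => ai; rewrite subSn//= IH.
Qed.

(** * Consequences of the Markov property along a grid *)

Section markov.
Variables (R : realType) (J : nat) (d : 'I_J.+1 -> nat).
Variables (M : R -> St d -> St d -> R) (Ptr : R -> R -> St d -> St d -> R).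
Variables (PI : 'I_J.+1 -> R -> R -> St d -> St d -> R) (pi0 : St d -> R).
Hypotheses (Mcont : forall e e', continuous (fun x => M x e e'))
  (hPtr : is_prodint M Ptr) (hPI : forall j, is_prodint (blockM M j j) (PI j)).
Variables (dm : measure_display) (Omega : measurableType dm) (P : probability Omega R)
  (X : R -> Omega -> St d).
Hypotheses (Xmeas : forall t e, 0 <= t -> measurable [set w | X t w = e])
  (Xpath : forall w, step_path (fun u => X u w))
  (Xinit : forall e, P [set w | X 0 w = e] = (pi0 e)%:E)
  (Xmarkov : forall s t, 0 <= s <= t -> forall A, natfilt X s A -> forall e,
     P (A `&` [set w | X t w = e]) =
     (\sum_(e' : St d) P (A `&` [set w | X s w = e']) * (Ptr s t e' e)%:E)%E).

Let Z (u : R) (w : Omega) := tag (X u w).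
Let pr (A : set Omega) : R := fine (P A).

Let Zstep w : step_path (fun r => Z r w).
Proof. exact: step_path_comp. Qed.

Let mX s A : natfilt X s A -> measurable A.
Proof. exact: natfilt_measurable. Qed.

Let prE A : measurable A -> P A = (pr A)%:E.
Proof. by move=> mA; rewrite fineK// fin_num_measure. Qed.

Let pr_ge0 A : 0 <= pr A.
Proof. exact: fine_ge0. Qed.

Let pr_le1 A : measurable A -> pr A <= 1.
Proof. by move=> mA; rewrite -lee_fin -prE// probability_le1. Qed.

Lemma markov_pr s t A e : 0 <= s -> s <= t -> natfilt X s A ->
  pr (A `&` [set w | X t w = e]) = \sum_e' pr (A `&` [set w | X s w = e']) * Ptr s t e' e.
Proof.
move=> s0 st hA; rewrite /pr (@Xmarkov s t _ A hA e) ?s0//.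
rewrite (eq_bigr (fun e' => (pr (A `&` [set w | X s w = e']) * Ptr s t e' e)%:E)); last first.
  move=> e' _; rewrite prE// ; apply: measurableI; last exact: Xmeas.
  exact: mX hA.
by rewrite sumEFin.
Qed.

Lemma markov_pr2 s t A e e' : 0 <= s -> s <= t -> natfilt X s A ->
  pr (A `&` [set w | X s w = e] `&` [set w | X t w = e']) =
  pr (A `&` [set w | X s w = e]) * Ptr s t e e'.
Proof.
move=> s0 st hA; rewrite (@markov_pr s t)//; last first.
  by apply: natfiltI => //; apply: natfilt_gen; rewrite s0 lexx.
rewrite (bigD1 e)//= -setIA setIid big1 ?addr0// => e2 e2e.
rewrite -setIA (_ : _ `&` [set w | X s w = e2] = set0) ?setI0.
  by rewrite /pr measure0 mul0r.
by rewrite -subset0 => w [/= -> /eqP]; rewrite eq_sym (negPf e2e).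
Qed.

Lemma pr_total t A : 0 <= t -> measurable A ->
  \sum_e pr (A `&` [set w | X t w = e]) = pr A.
Proof.
move=> t0 mA.
have mAe e : measurable (A `&` [set w | X t w = e]) by apply: measurableI => //; exact: Xmeas.
rewrite /pr -Rintegral_indic_pr// (eq_bigr (fun e => \int[P]_w \1_(A `&` [set w | X t w = e]) w)); last first.
  by move=> e _; rewrite Rintegral_indic_pr.
rewrite -Rintegral_sum_seq; last first.
  move=> e; apply: (@bounded_integrable _ _ _ _ _ 1); first exact: measurable_indic.
  by move=> w; rewrite indicE; case: (_ \in _); rewrite ?normr1 ?normr0.
apply: eq_Rintegral => w _; rewrite (bigD1 (X t w))//= big1 ?addr0.
  by rewrite !indicE in_setI [X in _ && X]mem_set// andbT.
by move=> e eX; rewrite indicE in_setI [X in _ && X]memNset ?andbF//= => /eqP; rewrite eq_sym (negPf eX).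
Qed.

Let path_meas h i q : 0 < h -> natfilt X (grid 0 h i) [set w | grid_path (fun r => Z r w) h i = q].
Proof.
move=> h0; rewrite natfiltE.
apply: (@measurable_grid_path R J _ (g_sigma_algebraType (natgen X (grid 0 h i))) Z (grid 0 h i)) => //.
- by rewrite /grid add0r mulr_ge0// ltW.
- by move=> r y hr; rewrite -natfiltE; exact: natfilt_comp.
- by rewrite /grid add0r.
Qed.

(** One application of the Markov property per step; at each jump the [h] gained by [path_weight]
    cancels the [h^-1] of [jump_scale]. *)
Lemma path_prob h i q e : 0 < h -> size q = i.+1 ->
  pr ([set w | grid_path (fun r => Z r w) h i = q] `&` [set w | X (grid 0 h i) w = e]) =
  path_weight h q * dfilter Ptr pi0 h q e.
Proof.
move=> h0; elim: i q e => [|i IH] [|y q] e //.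
  case: q => // _; rewrite /= mul1r grid0; case: ifPn => [/eqP te|te].
    rewrite (_ : _ `&` _ = [set w | X 0 w = e]) /pr ?Xinit//.
    by apply/seteqP; split => [w []//|w /= we]; split => //; rewrite /Z we te.
  rewrite (_ : _ `&` _ = set0) /pr ?measure0//.
  by rewrite -subset0 => w [/= [zy] we]; move: te; rewrite -we -zy eqxx.
case: q => [//|y' q] [sq].
have [te|te] := eqVneq (tag e) y; last first.
  rewrite dfilter_supp// mulr0 (_ : _ `&` _ = set0) /pr ?measure0//.
  by rewrite -subset0 => w [/= [zy _] we]; move: te; rewrite -we -zy eqxx.
rewrite (_ : _ `&` _ = [set w | grid_path (fun r => Z r w) h i = y' :: q] `&`
    [set w | X (grid 0 h i.+1) w = e]); last first.
  apply/seteqP; split => w /= [a b]; split => //; first by case: a.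
  by rewrite a /Z b te.
have g0 : 0 <= grid 0 h i by rewrite /grid add0r mulr_ge0// ltW.
rewrite (@markov_pr (grid 0 h i))//; last 2 first.
  by rewrite gridS lerDl ltW.
  exact: path_meas.
rewrite dfilter_cons te eqxx sq.
have sq' : size (y' :: q) = i.+1 by rewrite /= sq.
under eq_bigr do rewrite (IH _ _ sq').
under eq_bigr do rewrite -mulrA.
rewrite -mulr_sumr [path_weight _ [:: y, y' & q]]/= -mulrA; congr (_ * _).
rewrite mulrCA /jump_scale; case: ifP => _; first by rewrite !mulr1.
by rewrite divff ?mulr1// gt_eqF.
Qed.

(** The sign is read off a probability through [path_prob], not from the entries of [Ptr]. *)
Lemma dfilter_ge0 h i q e : 0 < h -> size q = i.+1 -> 0 <= dfilter Ptr pi0 h q e.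
Proof.
by move=> h0 sq; rewrite -(pmulr_rge0 _ (path_weight_gt0 q h0)) -(path_prob e h0 sq).
Qed.

Lemma filter_num_ge0 w u e : 0 < u -> 0 <= filter_num M PI pi0 (fun r => Z r w) u e.
Proof.
move=> u0; have uu : 0 < u <= u by rewrite u0 lexx.
have h := @grid_filter_cvg R J d M Ptr PI pi0 Mcont hPtr hPI dm Omega Z u u0 Zstep w u e uu.
apply: (cvgr_to_ge h); apply: nearW => n; apply: sumr_ge0 => i _; rewrite mulr_ge0//.
apply: (@dfilter_ge0 _ i); first by rewrite divr_gt0// exprn_gt0.
by rewrite size_grid_path.
Qed.

Let gpm h i : 0 < h -> forall q, measurable [set w | grid_path (fun r => Z r w) h i = q].
Proof. by move=> h0 q; apply: (@mX (grid 0 h i)); exact: path_meas. Qed.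

Lemma path_integral (F : seq 'I_J.+1 -> R) (B : set Omega) h i : 0 < h -> measurable B ->
  \int[P]_w (F (grid_path (fun r => Z r w) h i) * \1_B w) =
  \sum_(q <- paths J i) F q * pr ([set w | grid_path (fun r => Z r w) h i = q] `&` B).
Proof.
move=> h0 mB.
have mqB q : measurable ([set w | grid_path (fun r => Z r w) h i = q] `&` B).
  by apply: measurableI => //; exact: gpm.
have iqB q : P.-integrable setT (EFin \o (\1_([set w | grid_path (fun r => Z r w) h i = q] `&` B) : Omega -> R)).
  by apply: (@bounded_integrable _ _ _ _ _ 1); [exact: measurable_indic|exact: normr_indic_le1].
rewrite (eq_bigr (fun q => \int[P]_w (F q * \1_([set w | grid_path (fun r => Z r w) h i = q] `&` B) w))); last first.
  by move=> q _; rewrite RintegralZl// Rintegral_indic_pr.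
rewrite -Rintegral_sum_seq; last first.
  move=> q; apply: (@bounded_integrable _ _ _ _ _ `|F q|).
    by apply: measurable_funM => //; exact: measurable_indic.
  by move=> w; rewrite normrM ler_piMr// normr_indic_le1.
apply: eq_Rintegral => w _; rewrite [F (grid_path _ _ _)]grid_path_decomp mulr_suml.
apply: eq_bigr => q _; rewrite -mulrA; congr (_ * _); rewrite !indicE in_setI.
rewrite -natrM mulnb; congr ((_ && _)%:R); apply/eqP/idP; rewrite inE//.
Qed.

(* The [delta] in the denominator makes both sides continuous in the filter, so that the limit
   along the grids can be taken before letting [delta] tend to 0. *)
Lemma grid_estimate (F : seq 'I_J.+1 -> R) (delta h : R) i e : 0 < h -> 0 < delta ->
  (forall q, 0 <= F q <= 1) ->
  `|\int[P]_w (F (grid_path (fun r => Z r w) h i) * \1_[set w | X (grid 0 h i) w = e] w) -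
    \int[P]_w (F (grid_path (fun r => Z r w) h i) *
      (dfilter Ptr pi0 h (grid_path (fun r => Z r w) h i) e /
       (\sum_e' dfilter Ptr pi0 h (grid_path (fun r => Z r w) h i) e' + delta)))| <=
  delta * (J.+1%:R * expR (J.+1%:R * (i%:R * h))).
Proof.
move=> h0 d0 hF.
have g0 : 0 <= grid 0 h i by rewrite /grid add0r mulr_ge0// ltW.
rewrite path_integral//; last exact: Xmeas.
pose G q := F q * (dfilter Ptr pi0 h q e / (\sum_e' dfilter Ptr pi0 h q e' + delta)).
rewrite [X in _ - X](_ : _ = \int[P]_w (G (grid_path (fun r => Z r w) h i) * \1_[set: Omega] w)); last first.
  by apply: eq_Rintegral => w _; rewrite indicE in_setT mulr1.
rewrite path_integral// -sumrB.
apply: (@le_trans _ _ (delta * \sum_(q <- paths J i) path_weight h q)); last first.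
  by rewrite ler_pM2l// sum_path_weight// ltW.
rewrite mulr_sumr (le_trans (ler_norm_sum _ _ _))//.
rewrite big_seq [leRHS]big_seq; apply: ler_sum => q /size_paths sq.
rewrite (path_prob e h0 sq) setIT.
rewrite -(@pr_total (grid 0 h i))//; last exact: gpm.
under [X in _ - _ * X]eq_bigr do rewrite (path_prob _ h0 sq).
rewrite -mulr_sumr /G.
have c0 := path_weight_gt0 q h0; set c := path_weight h q in c0 *.
set V := dfilter Ptr pi0 h q e; set S := \sum_e' dfilter Ptr pi0 h q e'.
have V0 : 0 <= V by exact: (dfilter_ge0 _ h0 sq).
have VS : V <= S.
  by rewrite /S (bigD1 e)//= lerDl sumr_ge0// => e' _; exact: (dfilter_ge0 _ h0 sq).
have Sd : 0 < S + delta by rewrite ltr_wpDl// (le_trans V0).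
(* Writing [V] as the ratio times [S + delta] leaves only the [delta] part. As the ratio is at most
   1, the path contributes at most [delta] times its weight. *)
have -> : F q * (c * V) - F q * (V / (S + delta)) * (c * S) = F q * (V / (S + delta)) * (delta * c).
  have {1}-> : V = V / (S + delta) * (S + delta) by rewrite divfK// gt_eqF.
  by ring.
have r0 : 0 <= V / (S + delta) by rewrite divr_ge0// ltW.
have /andP[F0 F1] := hF q.
rewrite ger0_norm ?mulr_ge0 ?(ltW d0) ?(ltW c0)//.
rewrite ler_piMl ?mulr_ge0 ?(ltW d0) ?(ltW c0)//.
rewrite mulr_ile1// ler_pdivrMr// mul1r (le_trans VS)// lerDl ltW//.
by rewrite invr_ge0 ltW.
Qed.

(** The constant does not depend on [A]: the time [u] will be replaced by the grid point before it
    for events that change with the mesh. *)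
Lemma marginal_lipschitz (c : R) : exists2 C, 0 < C & exists2 eta, 0 < eta &
  forall s t A e, 0 <= s -> s <= t -> t <= c -> t - s <= eta -> natfilt X s A ->
  `|pr (A `&` [set w | X t w = e]) - pr (A `&` [set w | X s w = e])| <= C * (t - s).
Proof.
have [C C0 [eta eta0 hC]] := prodint_lipschitz Mcont hPtr c.
exists (#|{: St d}|%:R * C + 1); first by rewrite ltr_wpDl// mulr_ge0// ltW.
exists eta => // s t A e s0 st tc ts hA.
rewrite (@markov_pr s t)//.
have -> : pr (A `&` [set w | X s w = e]) = \sum_e' pr (A `&` [set w | X s w = e']) * (e' == e)%:R.
  by rewrite (bigD1 e)//= eqxx mulr1 big1 ?addr0// => e' /negPf ->; rewrite mulr0.
rewrite -sumrB (le_trans (ler_norm_sum _ _ _))//.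
apply: (@le_trans _ _ (#|{: St d}|%:R * (C * (t - s)))); last first.
  by rewrite mulrDl mulrA mul1r lerDl subr_ge0.
rewrite -sum1_card natr_sum mulr_suml; apply: ler_sum => e' _.
rewrite -mulrBr normrM ler_pM//; last exact: hC.
rewrite ger0_norm ?pr_ge0// pr_le1//; apply: measurableI; first exact: mX hA.
exact: Xmeas.
Qed.

(** * The filter formula on finite-dimensional cylinders of Z *)

Section cylinder.
Variables (s u : R) (L : seq (R * 'I_J.+1)).
Hypotheses (s0 : 0 <= s) (su : s < u) (Ls : all (fun p => 0 <= p.1 <= s) L).

Let u0 : 0 < u. Proof. exact: le_lt_trans su. Qed.
Let hh n := u / 2 ^+ n.
(** One less than the number of cells: this grid point is [u - hh n], the last one strictly before
    [u], as [dfilter_cvg] demands. *)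
Let ii n := (2 ^ n).-1.
Let hh0 n : 0 < hh n. Proof. by rewrite divr_gt0// exprn_gt0. Qed.
Let iiS n : (ii n).+1 = (2 ^ n)%N. Proof. by rewrite prednK// expn_gt0. Qed.
Let tS n : grid 0 (hh n) (ii n).+1 = u.
Proof. by rewrite iiS /grid add0r /hh natrX mulrC divfK// expf_neq0// pnatr_eq0. Qed.
Let tE n : grid 0 (hh n) (ii n) = u - hh n.
Proof. by rewrite -(tS n) gridS addrK. Qed.
Let t0 n : 0 <= grid 0 (hh n) (ii n).
Proof. by rewrite /grid add0r mulr_ge0// ltW. Qed.

Let idx n r := xget 0%N [set a | r <= grid 0 (hh n) a < r + hh n].
Let idxP n r : 0 <= r -> r <= grid 0 (hh n) (idx n r) < r + hh n.
Proof.
by move=> r0; rewrite /idx; case: xgetP => [a _ //|/(_ _)]; have [a ha] := grid_ceil (hh0 n) r0 => /(_ a).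
Qed.

Definition cylinder := [set w | all (fun p => Z p.1 w == p.2) L].

Let F n (q : seq 'I_J.+1) := all (fun p => nth ord0 q (ii n - idx n p.1) == p.2) L.

(** The times of the cylinder are rounded up, so right-continuity makes the sampled values
    eventually exact. The rounded times do not pass [u - hh n] once [hh n < u - s]. *)
Let F_near w : \forall n \near \oo, F n (grid_path (fun r => Z r w) (hh n) (ii n)) =
  all (fun p => Z p.1 w == p.2) L.
Proof.
rewrite /F; elim: L Ls => [_|[r y] l IH /= /andP[/andP[r0 rs] hl]]; first exact: nearW.
have [e e0 he] := (Zstep w).1 r r0.
have m0 : 0 < Num.min e (u - s) by rewrite lt_min e0 subr_gt0.
have /cvgrPdist_lt/(_ _ m0) := pow2_cvg0 u.
move: (IH hl); apply: filterS2 => n -> ; rewrite sub0r normrN gtr0_norm ?hh0//.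
rewrite -/(hh n) lt_min => /andP[hne hnu]; congr (_ && _).
have /andP[i1 i2] := idxP n r0.
have ir : (idx n r <= ii n)%N.
  rewrite leqNgt; apply/negP => /(grid_le 0 (ltW (hh0 n))); rewrite tS => h.
  have := le_lt_trans h i2; lra.
by rewrite nth_grid_path// he// i1/=; lra.
Qed.

Let mcyl : measurable cylinder.
Proof.
rewrite /cylinder; elim: L Ls => [_|[r y] l IH /= /andP[/andP[r0 rs] hl]].
  by rewrite (_ : [set w | _] = setT)//; apply/seteqP; split.
rewrite (_ : [set w | _] = [set w | Z r w = y] `&` [set w | all (fun p => Z p.1 w == p.2) l]).
  apply: measurableI; last exact: IH.
  by apply: (@mX r); apply: natfilt_comp; rewrite r0 lexx.
by apply/seteqP; split => w /=; [move=> /andP[/eqP]|move=> [-> ->]; rewrite eqxx].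
Qed.

Let D n := [set w | F n (grid_path (fun r => Z r w) (hh n) (ii n))].

Let hD n : natfilt X (grid 0 (hh n) (ii n)) (D n).
Proof.
set t := grid 0 (hh n) (ii n).
have h := @measurable_fun_grid_path R J _ (g_sigma_algebraType (natgen X t)) Z t (t0 n) _
  (fun q => (F n q)%:R) (hh n) (ii n) (hh0 n) _.
rewrite natfiltE (_ : D n = setT `&` (fun w => (F n (grid_path (Z^~ w) (hh n) (ii n)))%:R : R) @^-1` [set 1]).
  apply: h => //; first by move=> r y hr; rewrite -natfiltE; exact: natfilt_comp.
  by rewrite /t /grid add0r.
apply/seteqP; split => w /=; first by rewrite /D/= => ->.
by rewrite /D/= => -[_]; case: (F n _) => //= /esym/eqP; rewrite oner_eq0.
Qed.

Let FD n w : (F n (grid_path (fun r => Z r w) (hh n) (ii n)))%:R = \1_(D n) w :> R.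
Proof. by rewrite indicE; congr ((_ : bool)%:R); apply/idP/idP; rewrite inE. Qed.

Let D_cvg w : \1_(D n) w @[n --> \oo] --> (\1_cylinder w : R).
Proof.
apply: cvg_near_cst; have := F_near w; apply: filterS => n h; rewrite -FD h.
by rewrite indicE; congr ((_ : bool)%:R); apply/idP/idP; rewrite inE.
Qed.

Let mD n : measurable (D n). Proof. exact: mX (@hD n). Qed.

Let indI (A B : set Omega) : measurable A -> measurable B ->
  \int[P]_w (\1_A w * \1_B w) = pr (A `&` B).
Proof.
move=> mA mB; rewrite /pr -Rintegral_indic_pr; last exact: measurableI.
by apply: eq_Rintegral => w _; rewrite indicI.
Qed.

Let mXu e : measurable [set w | X u w = e]. Proof. by apply: Xmeas; exact: ltW. Qed.

Let lhs_cvg e :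
  pr (D n `&` [set w | X (grid 0 (hh n) (ii n)) w = e]) @[n --> \oo] -->
  pr (cylinder `&` [set w | X u w = e]).
Proof.
have [C C0 [eta eta0 hC]] := marginal_lipschitz u.
have c1 : pr (D n `&` [set w | X u w = e]) @[n --> \oo] --> pr (cylinder `&` [set w | X u w = e]).
  rewrite -indI//; under eq_cvg do rewrite -indI//.
  apply: (@Rintegral_cvg_bounded _ _ _ _ _ _ 1).
  - by move=> n; apply: measurable_funM; exact: measurable_indic.
  - by move=> n w; rewrite normrM mulr_ile1// normr_indic_le1.
  - by move=> w; apply: cvgMl; exact: D_cvg.
rewrite -[X in _ --> X]subr0.
rewrite (_ : (fun n => _) = (fun n => pr (D n `&` [set w | X u w = e]) -
  (pr (D n `&` [set w | X u w = e]) - pr (D n `&` [set w | X (grid 0 (hh n) (ii n)) w = e])))); last first.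
  by apply/funext => n; rewrite opprB addrC subrK.
apply: cvgB; first exact: c1.
apply/cvgrPdist_le => eps eps0.
have m0 : 0 < Num.min eta (eps / C) by rewrite lt_min eta0 divr_gt0.
have /cvgrPdist_lt/(_ _ m0) := pow2_cvg0 u.
apply: filterS => n; rewrite sub0r normrN gtr0_norm ?hh0// -/(hh n) lt_min => /andP[h1 h2].
rewrite sub0r normrN; have := hC (grid 0 (hh n) (ii n)) u (D n) e (t0 n) _ (lexx _) _ (@hD n).
have -> : u - grid 0 (hh n) (ii n) = hh n by rewrite tE; lra.
move=> /(_ _ _)/le_trans; apply; [by rewrite tE; have := hh0 n; lra|exact: ltW|].
by rewrite mulrC -ler_pdivlMr// ltW.
Qed.

Let V n w e := dfilter Ptr pi0 (hh n) (grid_path (fun r => Z r w) (hh n) (ii n)) e.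
Let fn w e := filter_num M PI pi0 (fun r => Z r w) u e.

Let V_ge0 n w e : 0 <= V n w e.
Proof. by apply: (dfilter_ge0 _ (hh0 n)); exact: size_grid_path. Qed.

Let fn_ge0 w e : 0 <= fn w e. Proof. exact: filter_num_ge0. Qed.

Let V_cvg w e : V n w e @[n --> \oo] --> fn w e.
Proof.
apply/cvgrPdist_le => eps eps0.
have [eta eta0 heta] := dfilter_cvg pi0 Mcont hPtr hPI (Zstep w) u0 eps0.
have /cvgrPdist_lt/(_ _ eta0) := pow2_cvg0 u.
apply: filterS => n; rewrite sub0r normrN gtr0_norm ?hh0// -/(hh n) => hlt.
rewrite distrC; apply: heta; first by rewrite hh0.
by rewrite tS lexx tE; have := hh0 n; lra.
Qed.

Let mV n e : measurable_fun setT (fun w => V n w e).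
Proof.
apply: (@measurable_fun_grid_path R J _ _ Z u (ltW u0) _ (fun q => dfilter Ptr pi0 (hh n) q e)) => //.
  by move=> r y /andP[r0 _]; apply: (@mX r); apply: natfilt_comp; rewrite r0 lexx.
by have := tE n; rewrite /grid add0r => ->; have := hh0 n; lra.
Qed.

Let mfn e : measurable_fun setT (fun w => fn w e).
Proof. by apply: (@measurable_fun_cvg _ _ _ _ (fun n w => V n w e)) => // w _; exact: V_cvg. Qed.

Let ratio01 (v : St d -> R) (delta : R) e : (forall e, 0 <= v e) -> 0 <= delta ->
  `|v e / (\sum_e' v e' + delta)| <= 1.
Proof.
move=> v0 d0; have vS : v e <= \sum_e' v e' + delta.
  by rewrite (bigD1 e)//= -addrA lerDl addr_ge0// sumr_ge0.
rewrite ger0_norm ?divr_ge0 ?(le_trans (v0 e))//.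
have := le_trans (v0 e) vS; rewrite le_eqVlt => /predU1P[<-|S0]; first by rewrite invr0 mulr0.
by rewrite ler_pdivrMr// mul1r.
Qed.

(** Bound of [sum_path_weight] for all grid paths up to time [u], whatever the mesh. *)
Let K := J.+1%:R * expR (J.+1%:R * u) : R.

Let mratio (v : Omega -> St d -> R) delta e : (forall e, measurable_fun setT (fun w => v w e)) ->
  measurable_fun setT (fun w => v w e / (\sum_e' v w e' + delta)).
Proof.
move=> mv; apply: measurable_funM => //.
apply: (@measurableT_comp _ _ _ _ _ _ (fun x : R => x^-1)); first exact: measurable_invr.
by apply: measurable_funD => //; apply: measurable_sum.
Qed.

Let cylinder_estimate e delta : 0 < delta ->
  `|pr (cylinder `&` [set w | X u w = e]) -
    \int[P]_w (\1_cylinder w * (fn w e / (\sum_e' fn w e' + delta)))| <= delta * K.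
Proof.
move=> d0.
pose b n := \int[P]_w (\1_(D n) w * (V n w e / (\sum_e' V n w e' + delta))).
have b_cvg : b n @[n --> \oo] --> \int[P]_w (\1_cylinder w * (fn w e / (\sum_e' fn w e' + delta))).
  apply: (@Rintegral_cvg_bounded _ _ _ _ _ _ 1).
  - by move=> n; apply: measurable_funM; [exact: measurable_indic|apply: mratio => e'; exact: mV].
  - move=> n w; rewrite normrM mulr_ile1 ?normr_indic_le1//; apply: ratio01; last exact: ltW.
    by move=> e'; exact: V_ge0.
  - move=> w; apply: cvgM; first exact: D_cvg.
    apply: cvgM; first exact: V_cvg.
    apply: cvgV; first by rewrite gt_eqF// ltr_wpDl// sumr_ge0.
    by apply: cvgD; [apply: cvg_rsum => e' _; exact: V_cvg|exact: cvg_cst].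
have ab : `|pr (D n `&` [set w | X (grid 0 (hh n) (ii n)) w = e]) - b n| @[n --> \oo] -->
    `|pr (cylinder `&` [set w | X u w = e]) -
    \int[P]_w (\1_cylinder w * (fn w e / (\sum_e' fn w e' + delta)))|.
  by apply: cvg_norm; apply: cvgB; [exact: lhs_cvg|exact: b_cvg].
apply: (cvgr_to_le ab); apply: nearW => n.
have := @grid_estimate (fun q => (F n q)%:R) delta (hh n) (ii n) e (hh0 n) d0 _.
under [X in `|X - _|]eq_Rintegral do rewrite FD.
under [X in `|_ - X|]eq_Rintegral do rewrite FD.
rewrite indI//; last by apply: Xmeas; exact: t0.
move=> /(_ _)/le_trans; apply; first by move=> q; case: (F n q); rewrite ?lexx ler01.
rewrite ler_pM2l// ler_pM2l ?ltr0n// ler_expR ler_pM2l ?ltr0n//.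
by have := tE n; rewrite /grid add0r => ->; have := hh0 n; lra.
Qed.

Lemma cylinder_filter e :
  \int[P]_w (\1_cylinder w * \1_[set w | X u w = e] w) =
  \int[P]_w (\1_cylinder w * (fn w e / \sum_e' fn w e')).
Proof.
rewrite indI//; apply/eqP; rewrite -subr_eq0 -normr_le0.
pose del n : R := 1 / 2 ^+ n.
have del0 n : 0 < del n by rewrite divr_gt0// exprn_gt0.
pose b n := \int[P]_w (\1_cylinder w * (fn w e / (\sum_e' fn w e' + del n))).
have b_cvg : b n @[n --> \oo] --> \int[P]_w (\1_cylinder w * (fn w e / \sum_e' fn w e')).
  apply: (@Rintegral_cvg_bounded _ _ _ _ _ _ 1).
  - by move=> n; apply: measurable_funM; [exact: measurable_indic|apply: mratio => e'; exact: mfn].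
  - move=> n w; rewrite normrM mulr_ile1 ?normr_indic_le1//; apply: ratio01; last exact: ltW.
    by move=> e'; exact: fn_ge0.
  - move=> w; apply: cvgMr.
    (* If the total vanishes then so does each nonnegative entry, and the ratio is 0 along the
       sequence and, as [0 / 0 = 0], in the limit. Otherwise the inverse is continuous at the
       total. *)
    have [S0|S0] := eqVneq (\sum_e' fn w e') 0.
      have -> : fn w e = 0.
        have /eqP := S0; rewrite psumr_eq0 => [/allP/(_ e)|e' _]; last exact: fn_ge0.
        by rewrite mem_index_enum => /(_ isT)/eqP.
      by under eq_cvg do rewrite mul0r; rewrite mul0r; exact: cvg_cst.
    apply: cvgMr; apply: cvgV => //; rewrite -[X in _ --> X]addr0.
    by apply: cvgD; [exact: cvg_cst|exact: pow2_cvg0].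
have h : `|pr (cylinder `&` [set w | X u w = e]) - b n| - del n * K @[n --> \oo] -->
    `|pr (cylinder `&` [set w | X u w = e]) -
      \int[P]_w (\1_cylinder w * (fn w e / \sum_e' fn w e'))| - 0 * K.
  apply: cvgB; last by apply: cvgMl; exact: pow2_cvg0.
  by apply: cvg_norm; apply: cvgB; [exact: cvg_cst|exact: b_cvg].
rewrite mul0r subr0 in h; apply: (cvgr_to_le h); apply: nearW => n.
by rewrite subr_le0; exact: cylinder_estimate.
Qed.

Lemma measurable_filter_ratio e : measurable_fun setT (fun w => fn w e / \sum_e' fn w e').
Proof.
have := @mratio fn 0 e mfn; under [X in measurable_fun _ X -> _]eq_fun do rewrite addr0.
exact.
Qed.

Lemma filter_ratio_le1 w e : `|fn w e / \sum_e' fn w e'| <= 1.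
Proof. by rewrite -[X in _ / X]addr0; exact: ratio01. Qed.

Lemma measurable_cylinder : measurable cylinder.
Proof. exact: mcyl. Qed.

End cylinder.

Let fnum u w e := filter_num M PI pi0 (fun r => Z r w) u e.

Lemma filter_formula s u A e : 0 <= s -> s < u -> natfilt Z s A ->
  pr (A `&` [set w | X u w = e]) =
  \int[P]_w (\1_A w * (fnum u w e / \sum_e' fnum u w e')).
Proof.
move=> s0 su hA.
have u0 : 0 <= u by rewrite (le_trans s0)// ltW.
(* Events at a single time generate F^Z_s but are not stable under intersection; concatenating lists
   makes cylinders a pi-system. *)
pose G := [set A | exists2 L, all (fun p => 0 <= p.1 <= s) L & A = cylinder L].
have GA : <<s G >> A.
  move: A hA; apply: sub_sigma_algebra2 => _ [r [y [rs ->]]].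
  exists [:: (r, y)]; first by rewrite /= rs.
  by apply/seteqP; split => w; rewrite /cylinder/= andbT => /eqP.
have mA : measurable A by apply: (@mX s); exact: natfilt_comp_sub hA.
have <- : \int[P]_w (\1_A w * \1_[set w | X u w = e] w) = pr (A `&` [set w | X u w = e]).
  rewrite /pr -Rintegral_indic_pr; last by apply: measurableI => //; exact: Xmeas.
  by apply: eq_Rintegral => w _; rewrite indicI.
apply: (@pi_lambda_Rintegral _ _ _ _ _ _ G) => //.
- by apply: measurable_indic; exact: Xmeas.
- exact: (@measurable_filter_ratio s u s0 su).
- by move=> w; exact: normr_indic_le1.
- by move=> w; exact: (@filter_ratio_le1 s u s0 su).
- by move=> _ [L Ls ->]; exact: (@measurable_cylinder s L Ls).
- move=> _ _ [L1 h1 ->] [L2 h2 ->]; exists (L1 ++ L2); first by rewrite all_cat h1.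
  by apply/seteqP; split => w; rewrite /cylinder/= all_cat => /andP.
- by exists [::] => //; apply/seteqP; split.
- by move=> _ [L Ls ->]; exact: (cylinder_filter s0 su Ls).
Qed.

(** * Expected number of jumps as a time integral *)

Section counting.
Variables (s t : R).
Hypotheses (s0 : 0 <= s) (st : s < t).

Let hh n := (t - s) / 2 ^+ n.
Let hh0 n : 0 < hh n. Proof. by rewrite divr_gt0 ?exprn_gt0// subr_gt0. Qed.
Let gE n : grid s (hh n) (2 ^ n) = t.
Proof. by rewrite /grid /hh natrX mulrC divfK ?expf_neq0 ?pnatr_eq0// addrC subrK. Qed.
Let g_ge n a : s <= grid s (hh n) a.
Proof. by rewrite /grid lerDl mulr_ge0// ltW. Qed.
Let g_ge0 n a : 0 <= grid s (hh n) a. Proof. exact: le_trans (g_ge n a). Qed.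
Let g_le n a : (a <= 2 ^ n)%N -> grid s (hh n) a <= t.
Proof. by move=> h; rewrite -[leRHS](gE n) /grid lerD2l ler_wpM2r ?ler_nat// ltW. Qed.

Let cnt (c : St d -> St d -> bool) n w : R :=
  \sum_(a < 2 ^ n) (c (X (grid s (hh n) a) w) (X (grid s (hh n) a.+1) w))%:R.

Let pair_set r r' e e' := [set w | X r w = e] `&` [set w | X r' w = e'].

Let cE (c : St d -> St d -> bool) r r' w :
  (c (X r w) (X r' w))%:R = \sum_e \sum_e' (c e e')%:R * \1_(pair_set r r' e e') w :> R.
Proof.
rewrite (bigD1 (X r w))//= (bigD1 (X r' w))//= !big1 ?addr0.
- by rewrite indicE mem_set ?mulr1.
- move=> e eX; rewrite big1// => e' _; rewrite indicE memNset ?mulr0// => -[/= E _].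
  by move: eX; rewrite E eqxx.
- move=> e' eX; rewrite indicE memNset ?mulr0// => -[/= _ E].
  by move: eX; rewrite E eqxx.
Qed.

Let mpair r r' e e' : 0 <= r -> 0 <= r' -> measurable (pair_set r r' e e').
Proof. by move=> r0 r0'; apply: measurableI; exact: Xmeas. Qed.

Let mcnt c n : measurable_fun setT (cnt c n).
Proof.
apply: measurable_sum => a; under eq_fun do rewrite cE.
apply: measurable_sum => e; apply: measurable_sum => e'; apply: measurable_funM => //.
by apply: measurable_indic; exact: mpair.
Qed.

Let cnt_ge0 c n w : 0 <= cnt c n w. Proof. by apply: sumr_ge0. Qed.

Let cnt_int A c n : natfilt X s A ->
  P.-integrable setT (EFin \o (fun w => \1_A w * cnt c n w)) /\
  \int[P]_w (\1_A w * cnt c n w) = \sum_(a < 2 ^ n) \sum_e \sum_e' (c e e')%:R *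
    (pr (A `&` [set w | X (grid s (hh n) a) w = e]) * Ptr (grid s (hh n) a) (grid s (hh n) a.+1) e e').
Proof.
move=> hA; have mA : measurable A by exact: mX hA.
split.
  apply: (@bounded_integrable _ _ _ _ _ (2 ^ n)%:R).
    by apply: measurable_funM => //; exact: measurable_indic.
  move=> w; rewrite normrM -[leRHS]mul1r ler_pM ?normr_indic_le1// ger0_norm// /cnt.
  apply: (@le_trans _ _ (\sum_(a < 2 ^ n) 1)); last by rewrite sumr_const card_ord.
  by apply: ler_sum => a _; case: (c _ _).
have E w : \1_A w * cnt c n w = \sum_(a < 2 ^ n) \sum_e \sum_e' (c e e')%:R *
    \1_(A `&` pair_set (grid s (hh n) a) (grid s (hh n) a.+1) e e') w.
  rewrite /cnt mulr_sumr; apply: eq_bigr => a _; rewrite cE mulr_sumr.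
  apply: eq_bigr => e _; rewrite mulr_sumr; apply: eq_bigr => e' _.
  by rewrite mulrCA indicI.
have mAp a e e' : measurable (A `&` pair_set (grid s (hh n) a) (grid s (hh n) a.+1) e e').
  by apply: measurableI => //; exact: mpair.
have i1 a e e' : P.-integrable setT (EFin \o (fun w => (c e e')%:R *
    (\1_(A `&` pair_set (grid s (hh n) a) (grid s (hh n) a.+1) e e') w : R))).
  apply: (@bounded_integrable _ _ _ _ _ 1).
    by apply: measurable_funM => //; apply: measurable_indic.
  by move=> w; rewrite normrM mulr_ile1 ?normr_indic_le1//; case: (c _ _); rewrite ?normr1 ?normr0.
have i2 a e : P.-integrable setT (EFin \o (fun w => \sum_e' (c e e')%:R *
    (\1_(A `&` pair_set (grid s (hh n) a) (grid s (hh n) a.+1) e e') w : R))).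
  by apply: integrable_rsum => e'; exact: i1.
have i3 a : P.-integrable setT (EFin \o (fun w => \sum_e \sum_e' (c e e')%:R *
    (\1_(A `&` pair_set (grid s (hh n) a) (grid s (hh n) a.+1) e e') w : R))).
  by apply: integrable_rsum => e; exact: i2.
under eq_Rintegral do rewrite E.
rewrite Rintegral_sum_seq//; apply: eq_bigr => a _.
rewrite Rintegral_sum_seq//; apply: eq_bigr => e _.
rewrite Rintegral_sum_seq//; apply: eq_bigr => e' _.
rewrite RintegralZl//; last first.
  by apply: (@bounded_integrable _ _ _ _ _ 1); [exact: measurable_indic|exact: normr_indic_le1].
rewrite Rintegral_indic_pr//; congr (_ * _); rewrite /pair_set setIA -/(pr _).
apply: markov_pr2 => //; first by rewrite gridS lerDl ltW.
by apply: natfilt_mono hA.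
Qed.

(** A sampled transition from [j] to [k] may vanish under refinement, when an intermediate state
    appears. Counting all changes of X is monotone instead, which makes it the envelope. *)
Let ne (e e' : St d) := e != e'.

Let natfiltT : natfilt X s setT.
Proof. exact: natfilt_setT. Qed.

Let cnt_ne_le n w : cnt ne n w <= cnt ne n.+1 w.
Proof.
have E a : grid s (hh n) a = grid s (hh n.+1) a.*2.
  by rewrite /grid /hh -mul2n natrM exprS invfM; field; rewrite expf_neq0 ?pnatr_eq0.
rewrite /cnt; under [leLHS]eq_bigr do rewrite !E.
rewrite expnS mul2n.
exact: (@refine_count_le R _ (fun a => X (grid s (hh n.+1) a) w)).
Qed.

Let cnt_ne_int_le n m : (n <= m)%N ->
  (\int[P]_w (cnt ne n w)%:E <= \int[P]_w (cnt ne m w)%:E)%E.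
Proof.
move=> nm.
have h0 m' w : setT w -> (0 <= (cnt ne m' w)%:E)%E by move=> _; rewrite lee_fin.
have hm m' : measurable_fun setT (fun w => (cnt ne m' w)%:E) by apply/measurable_EFinP.
apply: (@ge0_le_integral _ _ _ P setT measurableT _ _ (h0 n) (hm n) (hm m)) => w _; rewrite lee_fin.
have nd : nondecreasing_seq (fun n => cnt ne n w) by apply/nondecreasing_seqP.
exact: nd.
Qed.

Let cnt_ne_bound : exists B, forall n, (\int[P]_w (cnt ne n w)%:E <= B%:E)%E.
Proof.
have [C C0 [eta eta0 hC]] := prodint_lipschitz Mcont hPtr t.
set nn : R := #|{: St d}|%:R.
exists (nn * (nn * C) * (t - s)).
have big n : hh n <= eta -> (\int[P]_w (cnt ne n w)%:E <= (nn * (nn * C) * (t - s))%:E)%E.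
  move=> hn; have [i E] := cnt_int ne n natfiltT.
  have {}i : P.-integrable setT (EFin \o cnt ne n).
    by move: i; congr (P.-integrable _ _); apply/funext => w /=; rewrite indicT mul1r.
  rewrite -[leLHS]fineK ?lee_fin; last exact: integrable_fin_num i.
  have -> : fine (\int[P]_w (cnt ne n w)%:E) = \int[P]_w (\1_[set: Omega] w * cnt ne n w).
    by rewrite /Rintegral; congr fine; apply: eq_integral => w _; rewrite indicT mul1r.
  rewrite {}E; apply: (@le_trans _ _ (\sum_(a < 2 ^ n) (nn * (nn * C) * hh n))); last first.
    rewrite sumr_const card_ord -mulr_natr -mulrA; apply: ler_wpM2l.
      by rewrite !mulr_ge0// ltW.
    by rewrite /hh natrX divfK// expf_neq0// pnatr_eq0.
  apply: ler_sum => a _; set r := grid _ _ _; set r' := grid _ _ _.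
  have rr' : r' - r = hh n by rewrite /r' gridS -/r; lra.
  rewrite {1}/nn -sum1_card natr_sum !mulr_suml; apply: ler_sum => e _; rewrite mul1r.
  rewrite {1}/nn -sum1_card natr_sum !mulr_suml; apply: ler_sum => e' _; rewrite mul1r.
  rewrite /ne; case: eqVneq => ee'; first by rewrite mul0r mulr_ge0// ltW.
  rewrite mul1r; apply: (le_trans (ler_norm _)); rewrite normrM -[leRHS]mul1r ler_pM ?normr_indic_le1//.
    by rewrite ger0_norm ?pr_ge0// pr_le1//; apply: measurableI => //; apply: Xmeas; exact: g_ge0.
  have := hC r r' e e' (g_ge0 n a); rewrite rr' (negPf ee') subr0; apply => //.
    by rewrite -subr_ge0 rr' ltW.
  exact: g_le.
move=> n.
have /cvgrPdist_lt/(_ _ eta0) := pow2_cvg0 (t - s).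
move=> [m _ hm].
(* The Lipschitz estimate holds only for fine meshes; a coarse one is compared with a refinement of
   it. *)
apply: (@le_trans _ _ (\int[P]_w (cnt ne (n + m) w)%:E)%E); first by rewrite cnt_ne_int_le ?leq_addr.
apply: big; have := hm (n + m)%N (leq_addl _ _).
by rewrite /= sub0r normrN gtr0_norm ?hh0// => /ltW.
Qed.

Variables (j k : 'I_J.+1) (A : set Omega).
Hypotheses (jk : j != k) (hA : natfilt X s A).

Let c (e e' : St d) := (tag e == j) && (tag e' == k).
Let c_ne e e' : c e e' -> e != e'.
Proof. by move=> /andP[/eqP ej /eqP ek]; apply: contraNneq jk => ee; rewrite -ej -ek ee. Qed.

Let N r w := Ncount (fun u => Z u w) j k r.

Let cnt_cvg w : cnt c n w @[n --> \oo] --> N t w - N s w.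
Proof.
by apply: cvg_near_cst; have := Ncount_cvg (Zstep w) jk s0 st; apply: filterS => n <-.
Qed.

Let cnt_le n w : cnt c n w <= cnt ne n w.
Proof.
apply: ler_sum => a _; case: (boolP (c _ _)) => // /c_ne; rewrite /ne => -> //.
Qed.

Lemma count_integrable :
  P.-integrable setT (EFin \o (fun w => \1_A w * (N t w - N s w))) /\
  \int[P]_w (\1_A w * cnt c n w) @[n --> \oo] --> \int[P]_w (\1_A w * (N t w - N s w)).
Proof.
have mA : measurable A by exact: mX hA.
have [B hB] := cnt_ne_bound.
apply: (@Rintegral_cvg_monotone_dominated _ _ _ _ _ (cnt ne) _ B) => //.
- by move=> n; apply: measurable_funM => //; exact: measurable_indic.
- move=> n w; rewrite normrM -[leRHS]mul1r ler_pM ?normr_indic_le1//.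
  by rewrite ger0_norm.
- by move=> w; apply: cvgMr; exact: cnt_cvg.
Qed.

(** Expressed through [Ptr s u], this is continuous in [u] on the whole line; it is the probability
    of [A] and [X u = e] only from time [s] on. *)
Let q e u := \sum_e' pr (A `&` [set w | X s w = e']) * Ptr s u e' e.
Let f u := \sum_e \sum_e' (c e e')%:R * (q e u * M u e e').

Let cf : continuous f.
Proof.
move=> u; apply: (@cvg_rsum R _ _ _ _ xpredT (fun e u => \sum_e' (c e e')%:R * (q e u * M u e e'))) => e _.
apply: (@cvg_rsum R _ _ _ _ xpredT (fun e' u => (c e e')%:R * (q e u * M u e e'))) => e' _.
apply: cvgMr; apply: cvgM; last exact: Mcont.
apply: (@cvg_rsum R _ _ _ _ xpredT (fun e' u => pr (A `&` [set w | X s w = e']) * Ptr s u e' e)) => e2 _.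
by apply: cvgMr; exact: (prodint_continuous hPtr).
Qed.

Let qE u e : s <= u -> q e u = pr (A `&` [set w | X u w = e]).
Proof. by move=> su; rewrite (@markov_pr s u). Qed.

Lemma count_compensator :
  \int[P]_w (\1_A w * (N t w - N s w)) = \int[lebesgue_measure]_(u in `]s, t]) f u.
Proof.
have mA : measurable A by exact: mX hA.
have [_ hN] := count_integrable.
suff hf : \int[P]_w (\1_A w * cnt c n w) @[n --> \oo] --> \int[lebesgue_measure]_(u in `]s, t]) f u.
  by rewrite -(cvg_lim (@Rhausdorff R) hN) -(cvg_lim (@Rhausdorff R) hf).
apply/cvgrPdist_le => eps eps0.
set nn : R := #|{: St d}|%:R.
have nn0 : 0 <= nn by exact: ler0n.
(* Per cell, each of the [nn * nn] pairs of states and the Riemann sum contribute an error of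
   [eps' * hh n]; the cells add up to [t - s]. *)
have [eps' /andP[eps'0 _] heps] : exists2 e, 0 < e <= 1 & (nn * nn + 1) * (t - s) * e <= eps.
  by apply: small_factor => //; rewrite mulr_ge0 ?subr_ge0 ?addr_ge0 ?mulr_ge0 ?(ltW st).
have [e1 e10 h1] := prodint_first_order Mcont hPtr t eps'0.
have [e2 e20 h2] := riemann_first_order cf s t eps'0.
have m0 : 0 < Num.min e1 e2 by rewrite lt_min e10.
have /cvgrPdist_lt/(_ _ m0) := pow2_cvg0 (t - s).
apply: filterS => n; rewrite sub0r normrN gtr0_norm ?hh0// -/(hh n) lt_min => /andP[hn1 hn2].
have [_ ->] := cnt_int c n hA.
pose g x := \int[lebesgue_measure]_(u in `]s, x]) f u.
have -> : \int[lebesgue_measure]_(u in `]s, t]) f u =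
    \sum_(a < 2 ^ n) (g (grid s (hh n) a.+1) - g (grid s (hh n) a)).
  rewrite -(big_mkord xpredT (fun a => g (grid s (hh n) a.+1) - g (grid s (hh n) a))).
  by rewrite telescope_sumr// gE grid0 /g set_itvoc0 Rintegral_set0 subr0.
rewrite -sumrB (le_trans (ler_norm_sum _ _ _))//; apply: le_trans heps.
have -> : (nn * nn + 1) * (t - s) * eps' = \sum_(a < 2 ^ n) (nn * nn + 1) * eps' * hh n.
  by rewrite sumr_const card_ord -mulr_natr -[RHS]mulrA /hh natrX divfK ?expf_neq0 ?pnatr_eq0// mulrAC.
apply: ler_sum => a _; set r := grid s (hh n) a; set r' := grid s (hh n) a.+1.
have rr' : r' - r = hh n by rewrite /r' gridS -/r; lra.
have ler : r <= r' by rewrite -subr_ge0 rr' ltW.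
have r't : r' <= t by exact: g_le.
rewrite (le_trans (ler_distD ((r' - r) * f r) _ _))//.
have -> : (nn * nn + 1) * eps' * hh n = eps' * hh n + nn * nn * eps' * hh n by ring.
rewrite lerD//.
  by rewrite -rr'; apply: h2 => //; [exact: g_ge|rewrite rr'].
rewrite /f mulr_sumr -sumrB (le_trans (ler_norm_sum _ _ _))//.
rewrite {1}/nn -sum1_card natr_sum !mulr_suml; apply: ler_sum => e _; rewrite mul1r.
rewrite mulr_sumr -sumrB (le_trans (ler_norm_sum _ _ _))//.
rewrite {1}/nn -sum1_card natr_sum !mulr_suml; apply: ler_sum => e' _; rewrite mul1r.
case: (boolP (c e e')) => [/c_ne ee'|_]; last first.
  by rewrite !mul0r mulr0 subrr normr0 mulr_ge0// ltW.
rewrite !mul1r -qE ?g_ge// mulrCA -mulrBr normrM -[leRHS]mul1r ler_pM ?normr_indic_le1//.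
  by rewrite qE ?g_ge// ger0_norm ?pr_ge0// pr_le1//; apply: measurableI => //; apply: Xmeas; exact: g_ge0.
have := h1 r r' e e' (g_ge0 n a) ler r't.
by rewrite rr' (negPf ee') subr0 distrC; apply.
Qed.

Lemma count_compensatorE :
  (\int[P]_w (\1_A w * (N t w - N s w))%:E = \int[lebesgue_measure]_(u in `]s, t])
    (\sum_e \sum_e' (c e e')%:R * (pr (A `&` [set w | X u w = e]) * M u e e'))%:E)%E.
Proof.
have [iN _] := count_integrable.
rewrite -[LHS]fineK; last exact: integrable_fin_num iN.
have := count_compensator; rewrite /Rintegral => ->.
rewrite fineK; last by apply: integrable_fin_num => //; exact: continuous_itv_integrable.
apply: eq_integral => u; rewrite inE/= in_itv/= => /andP[su _]; congr (_%:E).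
by apply: eq_bigr => e _; apply: eq_bigr => e' _; rewrite qE// ltW.
Qed.

End counting.

(** * The integrated intensity: adaptedness, integrability and the martingale identity *)

Section intensity.
Hypothesis Moff : forall x e e', e != e' -> 0 <= M x e e'.
Variables (j k : 'I_J.+1).
Hypothesis (jk : j != k).

Let c (e e' : St d) := (tag e == j) && (tag e' == k).
Let lamw u w := lam M pi0 PI (fun r => Z r w) j k u.

Let c_ge0 u e e' : 0 <= (c e e')%:R * M u e e'.
Proof.
case: (boolP (c e e')) => [/andP[/eqP ej /eqP ek]|_]; last by rewrite mul0r.
by rewrite mul1r Moff//; apply: contraNneq jk => ee; rewrite -ej -ek ee.
Qed.

Let lamwE u w : 0 < u ->
  lamw u w = \sum_e \sum_e' fnum u w e / (\sum_e' fnum u w e') * ((c e e')%:R * M u e e').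
Proof.
move=> u0; rewrite /lamw lamE// mulr_suml big_mkcond/=; apply: eq_bigr => e _.
case: ifPn => te; last first.
  by rewrite big1// => e' _; rewrite /c (negPf te) mul0r mulr0.
rewrite mulr_suml big_mkcond/=; apply: eq_bigr => e' _; rewrite /c te /=.
by case: ifP => _; rewrite ?mul0r ?mulr0// mul1r mulrAC.
Qed.

Let ratio_ge0 u w e : 0 < u -> 0 <= fnum u w e / (\sum_e' fnum u w e').
Proof.
by move=> u0; rewrite divr_ge0 ?sumr_ge0// => [|e' _]; exact: filter_num_ge0.
Qed.

Let lamw_ge0 u w : 0 < u -> 0 <= lamw u w.
Proof.
move=> u0; rewrite lamwE//; apply: sumr_ge0 => e _; apply: sumr_ge0 => e' _.
by rewrite mulr_ge0// ratio_ge0.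
Qed.

Let lamw_le t : exists2 B, 0 < B & forall u w, 0 < u <= t -> lamw u w <= B.
Proof.
have [B B0 hB] := @fin_bounded R (St d * St d)%type (fun p x => M x p.1 p.2) 0 t (fun p => @Mcont p.1 p.2).
set nn : R := #|{: St d}|%:R.
exists (nn * (nn * B) + 1); first by rewrite ltr_wpDl// !mulr_ge0// ltW.
move=> u w /andP[u0 ut]; rewrite lamwE//.
apply: (@le_trans _ _ (nn * (nn * B))); last by rewrite lerDl.
rewrite {1}/nn -sum1_card natr_sum !mulr_suml; apply: ler_sum => e _; rewrite mul1r.
rewrite {1}/nn -sum1_card natr_sum !mulr_suml; apply: ler_sum => e' _.
rewrite ler_pM ?ratio_ge0//; last first.
  rewrite (le_trans _ (hB (e, e') u _)) ?(ltW u0)//=.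
  by case: (c _ _); rewrite ?mul1r ?mul0r// ler_norm.
exact: le_trans (ler_norm _) (@filter_ratio_le1 0 u (lexx _) u0 w e).
Qed.

Let lam_pr s u A : 0 <= s -> s < u -> natfilt Z s A ->
  \int[P]_w (\1_A w * lamw u w) =
  \sum_e \sum_e' (c e e')%:R * (pr (A `&` [set w | X u w = e]) * M u e e').
Proof.
move=> s0 su hA; have u0 : 0 < u by exact: le_lt_trans su.
have mA : measurable A by apply: (@mX s); exact: natfilt_comp_sub hA.
have mr e : measurable_fun setT (fun w => \1_A w * (fnum u w e / (\sum_e' fnum u w e'))).
  apply: measurable_funM; first exact: measurable_indic.
  exact: (@measurable_filter_ratio s u s0 su).
have br e w : `|\1_A w * (fnum u w e / (\sum_e' fnum u w e'))| <= 1.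
  by rewrite normrM mulr_ile1 ?normr_indic_le1//; exact: (@filter_ratio_le1 s u s0 su).
have i0 e : P.-integrable setT (EFin \o (fun w => \1_A w * (fnum u w e / (\sum_e' fnum u w e')))).
  by apply: (@bounded_integrable _ _ _ _ _ 1).
have i1 e e' : P.-integrable setT (EFin \o (fun w =>
    ((c e e')%:R * M u e e') * (\1_A w * (fnum u w e / (\sum_e' fnum u w e'))))).
  apply: (@bounded_integrable _ _ _ _ _ `|(c e e')%:R * M u e e'|).
    exact: measurable_funM.
  by move=> w; rewrite normrM ler_piMr.
have i2 e : P.-integrable setT (EFin \o (fun w => \sum_e'
    ((c e e')%:R * M u e e') * (\1_A w * (fnum u w e / (\sum_e' fnum u w e'))))).
  exact: integrable_rsum.
rewrite (@eq_Rintegral _ _ _ _ _ (fun w => \sum_e \sum_e'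
    ((c e e')%:R * M u e e') * (\1_A w * (fnum u w e / (\sum_e' fnum u w e'))))); last first.
  move=> w _; rewrite lamwE// mulr_sumr; apply: eq_bigr => e _; rewrite mulr_sumr.
  by apply: eq_bigr => e' _; rewrite [LHS]mulrA [RHS]mulrC.
rewrite Rintegral_sum_seq//; apply: eq_bigr => e _.
rewrite Rintegral_sum_seq//; apply: eq_bigr => e' _.
by rewrite RintegralZl// -(filter_formula e s0 su hA) -mulrA; congr (_ * _); rewrite mulrC.
Qed.

Let Lam s t w : \bar R := (\int[lebesgue_measure]_(u in `]s, t]) (lamw u w)%:E)%E.

(** Brings the integrand to the cut-off form in which [measurable_lam] provides joint
    measurability. *)
Let restrict_lam s t w u : 0 <= s ->
  ((fun u => (lamw u w)%:E) \_ `]s, t]) u =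
  (\1_(`]s, t]%classic : set R) u * (if 0 < u <= t then lamw u w else 0))%:E.
Proof.
move=> s0; rewrite patchE indicE; case: ifPn => [|_]; last by rewrite mul0r.
by rewrite inE/= in_itv/= => /andP[su ->]; rewrite (le_lt_trans s0 su) mul1r.
Qed.

Let joint_lam (dT : measure_display) (T : measurableType dT) (Z' : R -> T -> 'I_J.+1) (s t : R)
   (A : set T) : 0 < t -> (forall w, step_path (fun r => Z' r w)) ->
  (forall r y, 0 <= r <= t -> measurable [set w | Z' r w = y]) -> measurable A ->
  measurable_fun setT (fun p : T * R => (\1_A p.1 * (\1_(`]s, t]%classic : set R) p.2 *
    (if 0 < p.2 <= t then lam M pi0 PI (fun r => Z' r p.1) j k p.2 else 0)))%:E).
Proof.
move=> t0 st' mZ' mA; apply/measurable_EFinP; apply: measurable_funM.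
  by apply: measurableT_comp => //; exact: measurable_indic.
apply: measurable_funM.
  by apply: measurableT_comp => //; exact: measurable_indic.
exact: (measurable_lam pi0 Mcont hPtr hPI t0 st' mZ').
Qed.

Let joint_ge0 s t (A : set Omega) (p : Omega * R) :
  (0 <= (\1_A p.1 * (\1_(`]s, t]%classic : set R) p.2 *
    (if 0 < p.2 <= t then lam M pi0 PI (fun r => Z r p.1) j k p.2 else 0)))%:E)%E.
Proof.
rewrite lee_fin mulr_ge0// mulr_ge0//; case: ifPn => // /andP[u0 _].
exact: (lamw_ge0 p.1 u0).
Qed.

Let Zm t r y : 0 <= r <= t -> measurable [set w | Z r w = y].
Proof. by move=> /andP[r0 _]; apply: (@mX r); apply: natfilt_comp; rewrite r0 lexx. Qed.

Lemma lam_integral_adapted (t r : R) : 0 <= t -> natfilt Z t [set w | (Lam 0%R t w <= r%:E)%E].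
Proof.
rewrite le_eqVlt => /predU1P[<-|t0].
  have E w : Lam 0 0 w = 0%E by rewrite /Lam set_itvoc0 integral_set0.
  rewrite natfiltE; case: (leP 0 r) => r0.
    rewrite (_ : [set w | _] = setT)//; apply/seteqP; split => // w _.
    by rewrite /= E lee_fin.
  rewrite (_ : [set w | _] = set0)//; apply/seteqP; split => // w.
  by rewrite /= E lee_fin leNgt r0.
(* Tonelli's theorem is applied with F^Z_t as the sigma-algebra on [Omega]; measurability of the
   partial integral is then adaptedness. *)
have mj := @joint_lam _ (g_sigma_algebraType (natgen Z t)) Z 0 t setT t0 Zstep
  (fun r y hr => @natfilt_gen R Omega _ Z t r y hr) measurableT.
have := @measurable_fun_fubini_tonelli_F _ _ _ _ _ lebesgue_measure _ mj (joint_ge0 0 t setT).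
set F := fubini_F _ _ => mF.
have FE w : F w = Lam 0 t w.
  rewrite /F /fubini_F /Lam [RHS]integral_mkcond; apply: eq_integral => u _.
  by rewrite restrict_lam// indicT mul1r.
rewrite natfiltE (_ : [set w | _] = setT `&` F @^-1` `]-oo, r%:E]).
  by apply: mF => //; exact: emeasurable_itv.
by apply/seteqP; split => w /=; rewrite ?in_itv/= FE => // -[].
Qed.

Lemma lam_integral_integrable t : 0 <= t -> P.-integrable setT (Lam 0 t).
Proof.
rewrite le_eqVlt => /predU1P[<-|t0].
  rewrite (_ : Lam 0 0 = cst 0%E); first exact: integrable0.
  by apply/funext => w; rewrite /Lam set_itvoc0 integral_set0.
have mj := @joint_lam _ Omega Z 0 t setT t0 Zstep (@Zm t) measurableT.
have := @measurable_fun_fubini_tonelli_F _ _ _ _ _ lebesgue_measure _ mj (joint_ge0 0 t setT).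
set F := fubini_F _ _ => mF.
have FE w : F w = Lam 0 t w.
  rewrite /F /fubini_F /Lam [RHS]integral_mkcond; apply: eq_integral => u _.
  by rewrite restrict_lam// indicT mul1r.
have [B B0 hB] := lamw_le t.
have Lam_ge0 w : (0 <= Lam 0%R t w)%E.
  by apply: integral_ge0 => u /=; rewrite in_itv/= => /andP[u0 _]; rewrite lee_fin lamw_ge0.
have Lam_le w : (Lam 0%R t w <= (B * t)%:E)%E.
  have -> : Lam 0 t w = (\int[lebesgue_measure]_(u in `]0%R, t]) (if 0 < u <= t then lamw u w else 0)%:E)%E.
    by apply: eq_integral => u; rewrite inE/= in_itv/= => ->.
  apply: (@le_trans _ _ (\int[lebesgue_measure]_(u in `]0%R, t]) (cst B%:E u))%E); last first.
    by rewrite integral_cst//= lebesgue_measure_itv/= lte_fin t0 -EFinB -EFinM subr0.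
  apply: ge0_le_integral => //.
  - by move=> u /=; rewrite in_itv/= => /[dup] ut /andP[u0 _]; rewrite ut lee_fin lamw_ge0.
  - apply: measurable_funTS; apply/measurable_EFinP.
    have := @measurable_lam R J d M Ptr PI pi0 Mcont hPtr hPI _ Omega Z t t0 Zstep (@Zm t) j k.
    by move=> mL; exact: (measurable_fun_pair2 w mL).
  - by move=> u /=; rewrite in_itv/= => ut; rewrite ut lee_fin; exact: hB.
apply: (@le_integrable _ _ _ P setT measurableT _ (cst (B * t)%:E)).
- by rewrite (_ : Lam 0 t = F)//; apply/funext => w; rewrite FE.
- by move=> w _; rewrite gee0_abs// (le_trans (Lam_le w))//= lee_fin ler_norm.
- by apply: (@bounded_integrable _ _ _ P (cst (B * t)) `|B * t|).
Qed.

(** The count identity sees [A] as an event of F^X_s, the filter formula as an event of F^Z_s; the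
    reduction to the information in Z happens only through the latter. *)
Lemma lam_martingale s t A : 0 <= s -> s < t -> natfilt Z s A ->
  (\int[P]_(w in A) (Ncount (fun u => Z u w) j k t - Ncount (fun u => Z u w) j k s)%:E =
   \int[P]_(w in A) Lam s t w)%E.
Proof.
move=> s0 st hA; have t0 : 0 < t by exact: le_lt_trans st.
have hXA : natfilt X s A by exact: natfilt_comp_sub hA.
have mA : measurable A by exact: mX hXA.
have [iN _] := count_integrable s0 st jk hXA.
have -> : (\int[P]_(w in A) (Ncount (fun u => Z u w) j k t - Ncount (fun u => Z u w) j k s)%:E =
   \int[P]_w (\1_A w * (Ncount (fun u => Z u w) j k t - Ncount (fun u => Z u w) j k s))%:E)%E.
  rewrite integral_mkcond; apply: eq_integral => w _; rewrite patchE indicE.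
  by case: ifPn => _; rewrite ?mul1r ?mul0r.
rewrite (count_compensatorE s0 st jk hXA).
have mj := @joint_lam _ Omega Z s t A t0 Zstep (@Zm t) mA.
have -> : (\int[P]_(w in A) Lam s t w = \int[P]_w \int[lebesgue_measure]_u
    (\1_A w * (\1_(`]s, t]%classic : set R) u * (if (0 < u <= t)%R then lamw u w else 0)))%:E)%E.
  rewrite integral_mkcond; apply: eq_integral => w _; rewrite patchE indicE.
  case: ifPn => _; last first.
    by under eq_integral do rewrite mul0r; rewrite integral0.
  rewrite /Lam integral_mkcond; apply: eq_integral => u _.
  by rewrite restrict_lam// mul1r.
(* The intensity is nonnegative because [j] and [k] differ, so the integrals may be exchanged
   without an integrability condition; at fixed [u] the inner expectation is then given by
   [lam_pr]. *)
rewrite (@fubini_tonelli _ _ _ _ _ P lebesgue_measure _ mj (joint_ge0 s t A)).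
rewrite integral_mkcond; apply: eq_integral => u _; rewrite patchE.
under [RHS]eq_integral do rewrite [\1_(`]s, t]%classic : set R) u]indicE.
case: ifPn => [|_]; last first.
  by under eq_integral do rewrite mul0r mulr0; rewrite integral0.
rewrite inE/= in_itv/= => /andP[su ut].
have u0 : 0 < u by exact: le_lt_trans su.
rewrite -(lam_pr s0 su hA) u0 ut.
under [RHS]eq_integral do rewrite mul1r.
rewrite /Rintegral fineK//; apply: integrable_fin_num => //.
have [B B0 hB] := lamw_le u.
apply: (@bounded_integrable _ _ _ _ _ B).
  apply: measurable_funM; first exact: measurable_indic.
  have mL := @measurable_lam R J d M Ptr PI pi0 Mcont hPtr hPI _ Omega Z t t0 Zstep (@Zm t) j k.
  by have := measurable_fun_pair1 u mL; rewrite /= u0 ut.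
move=> w; rewrite normrM -[leRHS]mul1r ler_pM ?normr_indic_le1//.
by rewrite ger0_norm ?lamw_ge0// hB// u0 lexx.
Qed.

End intensity.

End markov.

Theorem theorem4p2 (R : realType) (J : nat) (d : 'I_J.+1 -> nat)
  (dpos : forall j, (0 < d j)%N)
  (M : R -> St d -> St d -> R)
  (Mcont : forall e e', continuous (fun x => M x e e'))
  (Moff : forall x e e', e != e' -> 0 <= M x e e')
  (Mrow : forall x e, \sum_e' M x e e' = 0)
  (Ptr : R -> R -> St d -> St d -> R) (hPtr : is_prodint M Ptr)
  (PI : 'I_J.+1 -> R -> R -> St d -> St d -> R)
  (hPI : forall j, is_prodint (blockM M j j) (PI j))
  (pi0 : St d -> R) (hpi0 : forall e, tag e != ord0 -> pi0 e = 0)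
  (dm : measure_display) (Omega : measurableType dm) (P : probability Omega R)
  (X : R -> Omega -> St d)
  (Xmeas : forall t e, 0 <= t -> measurable [set w | X t w = e])
  (Xpath : forall w, step_path (fun u => X u w))
  (Xinit : forall e, P [set w | X 0 w = e] = (pi0 e)%:E)
  (Xmarkov : forall s t, 0 <= s <= t -> forall A, natfilt X s A -> forall e,
     P (A `&` [set w | X t w = e]) =
     (\sum_(e' : St d) P (A `&` [set w | X s w = e']) * (Ptr s t e' e)%:E)%E)
  (j k : 'I_J.+1) (jk : j != k) :
  let Z := fun (u : R) (w : Omega) => tag (X u w) in
  let N := fun (t : R) (w : Omega) => Ncount (fun u => Z u w) j k t in
  let Lam := fun (s t : R) (w : Omega) =>
     (\int[lebesgue_measure]_(u in `]s, t]) (lam M pi0 PI (fun u => Z u w) j k u)%:E)%E in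
  (* Lambda_jk is F^Z-adapted (it is continuous, hence predictable) *)
  (forall t, 0 <= t -> forall r : R,
     natfilt Z t [set w | (Lam 0%R t w <= r%:E)%E]) /\
  (* integrability *)
  (forall t, 0 <= t ->
     P.-integrable setT (fun w => (N t w)%:E) /\ P.-integrable setT (Lam 0%R t)) /\
  (* N_jk - Lambda_jk is an (F^Z, P)-martingale *)
  (forall s t, 0 <= s <= t -> forall A, natfilt Z s A ->
     (\int[P]_(w in A) (N t w - N s w)%:E)%E = (\int[P]_(w in A) Lam s t w)%E).
Proof.
move=> Z N Lam; split; [|split].
- move=> t t0 r; exact: (lam_integral_adapted Mcont hPtr hPI Xmeas Xpath Xinit Xmarkov Moff jk r t0).
- move=> t t0; split; last first.
    exact: (lam_integral_integrable Mcont hPtr hPI Xmeas Xpath Xinit Xmarkov Moff jk t0).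
  move: t0; rewrite le_eqVlt => /predU1P[<-|t0].
    rewrite (_ : (fun w => _) = cst 0%E); first exact: integrable0.
    by apply/funext => w; rewrite /N Ncount0.
  have [iN _] := count_integrable Mcont hPtr Xmeas Xpath Xmarkov (lexx 0) t0 jk
    (@natfilt_setT R Omega _ X 0).
  move: iN; congr (P.-integrable _ _); apply/funext => w /=.
  by rewrite indicT mul1r /N Ncount0 subr0.
- move=> s t /andP[s0]; rewrite le_eqVlt => /predU1P[<-|st] A hA.
    rewrite /Lam set_itvoc0; under eq_integral do rewrite subrr.
    by under [RHS]eq_integral do rewrite integral_set0.
  exact: (lam_martingale Mcont hPtr hPI Xmeas Xpath Xinit Xmarkov Moff jk s0 st hA).
Qed.
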